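(* (Completeness of $\mathbf{Tm}^*$.) Let $\Theta$ be a first-order signature and let $\Gamma\cup\{\varphi\}\subseteq For(\Theta)$ be a set of formulas. If $\Gamma\models_{\mathbf{Tm}^*}\varphi$, then $\Gamma\vdash_{\mathbf{Tm}^*}\varphi$.
   Context: SYNTAX. A first-order signature $\Theta$ consists of a nonempty set of predicate symbols, each of arity $\geq 1$, among which there is a binary symbol $\approx$ (identity); a possibly empty set of function symbols, each of arity $\geq 1$; and a possibly empty set of individual constants. $Var=\{x_1,x_2,\ldots\}$ is a fixed denumerable set of variables. Terms are defined as usual. The set $For(\Theta)$ of formulas is generated from atomic formulas $P\tau_1\ldots\tau_n$ (in particular $(\tau_1\approx\tau_2)$) by $\neg\alpha$, $\Box\alpha$, $\forall x\alpha$ and $\alpha\to\beta$. Abbreviations: $\Diamond\alpha:=\neg\Box\neg\alpha$, $\alpha\vee\beta:=\neg\alpha\to\beta$, $\alpha\wedge\beta:=\neg(\alpha\to\neg\beta)$, $\exists x\alpha:=\neg\forall x\neg\alpha$. Free and bound occurrences and ''term free for a variable in a formula'' are as usual. $\alpha[x/\tau]$ is the result of simultaneously replacing every free occurrence of $x$ in $\alpha$ by $\tau$. If $y$ is a variable free for $x$ in $\alpha$, $\alpha[x\wr y]$ denotes any formula obtained from $\alpha$ by replacing some (not necessarily all, maybe none) free occurrences of $x$ by $y$. Two formulas are variants of each other if one is obtained from the other by adding or deleting void quantifiers (quantifiers $\forall x\alpha$ with $x$ not free in $\alpha$) or by renaming bound variables (keeping the same free variables in the same places). HILBERT CALCULUS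 $\mathbf{Tm}^*$. Axiom schemas: (Ax1) $\alpha\to(\beta\to\alpha)$; (Ax2) $(\alpha\to(\beta\to\gamma))\to((\alpha\to\beta)\to(\alpha\to\gamma))$; (Ax3) $(\neg\beta\to\neg\alpha)\to((\neg\beta\to\alpha)\to\beta)$; (Ax4) $\forall x\alpha\to\alpha[x/\tau]$ if $\tau$ is free for $x$ in $\alpha$; (Ax5) $\forall x(\alpha\to\beta)\to(\alpha\to\forall x\beta)$ if $x$ is not free in $\alpha$; (Ax6) $\alpha\to\beta$ if $\alpha$ is a variant of $\beta$; (Ax7) $\forall x(x\approx x)$; (Ax8) $(x\approx y)\to(\alpha\to\alpha[x\wr y])$ if $y$ is a variable free for $x$ in $\alpha$; (N=) $(x\approx y)\to\Box(x\approx y)$; (P=) $\neg(x\approx y)\to\Box\neg(x\approx y)$; (K) $\Box(\alpha\to\beta)\to(\Box\alpha\to\Box\beta)$; (K1) $\Box(\alpha\to\beta)\to(\Diamond\alpha\to\Diamond\beta)$; (K2) $\Diamond(\alpha\to\beta)\to(\Box\alpha\to\Diamond\beta)$; (M1) $\Box\neg\alpha\to\Box(\alpha\to\beta)$; (M2) $\Box\beta\to\Box(\alpha\to\beta)$; (M3) $\Diamond\beta\to\Diamond(\alpha\to\beta)$; (M4) $\Diamond\neg\alpha\to\Diamond(\alpha\to\beta)$; (T) $\Box\alpha\to\alpha$; (DN1) $\Box\alpha\to\Box\neg\neg\alpha$; (DN2) $\Box\neg\neg\alpha\to\Box\alpha$; (BF) $\forall x\Box\alpha\to\Box\forall x\alpha$;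 (CBF) $\Box\forall x\alpha\to\forall x\Box\alpha$; (NBF) $\forall x\Diamond\alpha\to\Diamond\forall x\alpha$; (PBF) $\Diamond\forall x\alpha\to\forall x\Diamond\alpha$. Rules: (MP) from $\alpha$ and $\alpha\to\beta$ infer $\beta$; (Gen) from $\alpha$ infer $\forall x\alpha$. $\Gamma\vdash_{\mathbf{Tm}^*}\alpha$ means there is a finite sequence ending in $\alpha$, each member of which is an element of $\Gamma$, an axiom instance, or follows from earlier members by (MP) or (Gen) (the usual notion of derivation from premises in Hilbert calculi; (Gen) may be applied to premises). TRUTH VALUES. $V_4=\{T^+,C^+,C^-,F^-\}$, with designated values $T^+,C^+$. Multioperations: $\tilde\neg T^+=\{F^-\}$, $\tilde\neg C^+=\{C^-\}$, $\tilde\neg C^-=\{C^+\}$, $\tilde\neg F^-=\{T^+\}$; $\tilde\Box T^+=\{T^+,C^+\}$ and $\tilde\Box C^+=\tilde\Box C^-=\tilde\Box F^-=\{C^-,F^-\}$; the values $a\,\tilde\to\,b$ for $b=T^+,C^+,C^-,F^-$ in this order are: for $a=T^+$: $\{T^+\},\{C^+\},\{C^-\},\{F^-\}$; for $a=C^+$: $\{T^+\},\{T^+,C^+\},\{C^-\},\{C^-\}$; for $a=C^-$: $\{T^+\},\{T^+,C^+\},\{T^+,C^+\},\{C^+\}$; for $a=F^-$: $\{T^+\},\{T^+\},\{T^+\},\{T^+\}$. For $\emptyset\neq X\subseteq V_4$, $\tilde\forall_4^d(X)=\{\min X\}$ with respect to the chain $F^-\leq C^-\leq C^+\leq T^+$.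 SEMANTICS. A first-order structure for $\mathbf{Tm}^*$ is $\mathfrak A=\langle U,\cdot^{\mathfrak A}\rangle$ with $U\neq\emptyset$, where each $n$-ary predicate $P$ is interpreted as a pair $(\mathfrak a^{\mathfrak A}(P),\mathfrak c^{\mathfrak A}(P))$ of subsets of $U^n$, with $\mathfrak a^{\mathfrak A}(\approx)=\{(a,a):a\in U\}$ and $\mathfrak c^{\mathfrak A}(\approx)=\emptyset$; constants are interpreted as elements of $U$, and $n$-ary function symbols as functions $U^n\to U$. An assignment is a function $s:Var\to U$; $\mathsf A(\mathfrak A)$ is the set of assignments; $\mathsf E_x(s)$ is the set of assignments agreeing with $s$ on all variables other than $x$; $s^x_a\in\mathsf E_x(s)$ is the one with $s^x_a(x)=a$. The denotation $[\![\tau]\!]^{\mathfrak A}_s\in U$ of a term is defined as usual. A valuation over $\mathfrak A$ is a function $v:For(\Theta)\times\mathsf A(\mathfrak A)\to V_4$ such that, for all $s$: 1. with $\vec u=([\![\tau_1]\!]^{\mathfrak A}_s,\ldots,[\![\tau_n]\!]^{\mathfrak A}_s)$, $v(P\tau_1\ldots\tau_n,s)$ is $T^+$ iff $\vec u\in\mathfrak a^{\mathfrak A}(P)\setminus\mathfrak c^{\mathfrak A}(P)$; $C^+$ iff $\vec u\in\mathfrak a^{\mathfrak A}(P)\cap\mathfrak c^{\mathfrak A}(P)$; $C^-$ iff $\vec u\in\mathfrak c^{\mathfrak A}(P)\setminus\mathfrak a^{\mathfrak A}(P)$; $F^-$ iff $\vec u\in U^n\setminus(\mathfrak a^{\mathfrak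 A}(P)\cup\mathfrak c^{\mathfrak A}(P))$; 2. $v((\tau_1\approx\tau_2),s)=T^+$ iff $[\![\tau_1]\!]^{\mathfrak A}_s=[\![\tau_2]\!]^{\mathfrak A}_s$, and $=F^-$ iff $[\![\tau_1]\!]^{\mathfrak A}_s\neq[\![\tau_2]\!]^{\mathfrak A}_s$; 3. $v(\#\alpha,s)\in\tilde\#\,v(\alpha,s)$ for $\#\in\{\neg,\Box\}$; 4. $v(\alpha\to\beta,s)\in v(\alpha,s)\,\tilde\to\,v(\beta,s)$; 5. $v(\forall x\alpha,s)\in\tilde\forall_4^d(\{v(\alpha,s'):s'\in\mathsf E_x(s)\})$; 6. if $\tau$ is free for $z$ in $\varphi$ and $b=[\![\tau]\!]^{\mathfrak A}_s$, then $v(\varphi[z/\tau],s)=v(\varphi,s^z_b)$; 7. if $\varphi,\varphi'$ are variants, then $v(\varphi,s)=v(\varphi',s)$; 8. if $y$ is a variable free for $x$ in $\varphi$, then $v((x\approx y)\to(\varphi\to\varphi[x\wr y]),s)\in\{T^+,C^+\}$. A formula $\alpha$ is true in $(\mathfrak A,v)$ if $v(\alpha,s)\in\{T^+,C^+\}$ for every assignment $s$. $\Gamma\models_{\mathbf{Tm}^*}\alpha$ means: for every structure $\mathfrak A$ and every valuation $v$ over $\mathfrak A$, if every $\gamma\in\Gamma$ is true in $(\mathfrak A,v)$ then $\alpha$ is true in $(\mathfrak A,v)$. *)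

(* Defs.v *)
From Stdlib Require List.
From mathcomp Require Import all_boot.
From mathcomp Require Import classical_sets.

Set Implicit Arguments.
Unset Strict Implicit.
Unset Printing Implicit Defensive.

Local Open Scope classical_set_scope.

Record signature := Signature {
  pred_sym : Type;
  par : pred_sym -> nat;
  par_gt0 : forall P, 0 < par P;
  ident : pred_sym;
  par_ident : par ident = 2;
  fun_sym : Type;
  far : fun_sym -> nat;
  far_gt0 : forall f, 0 < far f;
  const_sym : Type
}.

(* The ordered pair (a, b), as a tuple of any length n; it is only used with
   n = par ident, which is 2 but only propositionally. *)
Definition pair2 {T : Type} {n : nat} (a b : T) : T ^ n :=
  [ffun i : 'I_n => if nat_of_ord i == 0 then a else b].

Inductive term (Th : signature) : Type :=
| Var of nat
| Cst of const_sym Th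
| App (f : fun_sym Th) of (term Th ^ far f)%type.

Arguments Var {Th}.
Arguments Cst {Th}.
Arguments App {Th}.

Inductive form (Th : signature) : Type :=
| Atom (P : pred_sym Th) of (term Th ^ par P)%type
| Neg of form Th
| Box of form Th
| All of nat & form Th
| Imp of form Th & form Th.

Arguments Atom {Th}.

Definition Eqn {Th : signature} (t1 t2 : term Th) : form Th :=
  Atom (ident Th) (pair2 t1 t2).

Definition Dia {Th : signature} (A : form Th) : form Th := Neg (Box (Neg A)).

Fixpoint occurs {Th : signature} (x : nat) (t : term Th) : bool :=
  match t with
  | Var y => y == x
  | Cst _ => false
  | App f a => [exists i, occurs x (a i)]
  end.

Fixpoint free_in {Th : signature} (x : nat) (A : form Th) : bool :=
  match A with
  | Atom P a => [exists i, occurs x (a i)]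
  | Neg B | Box B => free_in x B
  | All y B => (y != x) && free_in x B
  | Imp B C => free_in x B || free_in x C
  end.

Fixpoint tsubst {Th : signature} (x : nat) (u t : term Th) : term Th :=
  match t with
  | Var y => if y == x then u else Var y
  | Cst c => Cst c
  | App f a => App f [ffun i => tsubst x u (a i)]
  end.

(* Literal replacement of the free occurrences of x: it does not rename bound
   variables, and is therefore always guarded by [free_for]. *)
Fixpoint subst {Th : signature} (x : nat) (u : term Th) (A : form Th) :
    form Th :=
  match A with
  | Atom P a => Atom P [ffun i => tsubst x u (a i)]
  | Neg B => Neg (subst x u B)
  | Box B => Box (subst x u B)
  | All y B => if y == x then All y B else All y (subst x u B)
  | Imp B C => Imp (subst x u B) (subst x u C)
  end.

(* [free_for u x A]: no free occurrence of x in A lies in the scope of a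
   quantifier binding a variable of u. *)
Fixpoint free_for {Th : signature} (u : term Th) (x : nat) (A : form Th) :
    bool :=
  match A with
  | Atom _ _ => true
  | Neg B | Box B => free_for u x B
  | All y B => free_in x (All y B) ==> ~~ occurs y u && free_for u x B
  | Imp B C => free_for u x B && free_for u x C
  end.

(* [trepl x y t t'] and [frepl x y A A']: the second expression results from
   the first by replacing some (maybe no) free occurrences of x by y. *)
Inductive trepl {Th : signature} (x y : nat) : term Th -> term Th -> Prop :=
| trepl_id t : trepl x y t t
| trepl_var : trepl x y (Var x) (Var y)
| trepl_app f (a b : (term Th ^ far f)%type) :
    (forall i, trepl x y (a i) (b i)) -> trepl x y (App f a) (App f b).

Inductive frepl {Th : signature} (x y : nat) : form Th -> form Th -> Prop :=
| frepl_id A : frepl x y A A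
| frepl_atom P (a b : (term Th ^ par P)%type) :
    (forall i, trepl x y (a i) (b i)) -> frepl x y (Atom P a) (Atom P b)
| frepl_neg A B : frepl x y A B -> frepl x y (Neg A) (Neg B)
| frepl_box A B : frepl x y A B -> frepl x y (Box A) (Box B)
| frepl_all z A B : z != x -> frepl x y A B -> frepl x y (All z A) (All z B)
| frepl_imp A B A' B' :
    frepl x y A A' -> frepl x y B B' -> frepl x y (Imp A B) (Imp A' B').

(* Any number of additions or deletions of void quantifiers and renamings of
   bound variables, performed anywhere inside the formula. *)
Inductive variant {Th : signature} : form Th -> form Th -> Prop :=
| variant_void x A : ~~ free_in x A -> variant A (All x A)
| variant_rename x y A :
    ~~ free_in y A -> free_for (Var y) x A ->
    variant (All x A) (All y (subst x (Var y) A))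
| variant_refl A : variant A A
| variant_sym A B : variant A B -> variant B A
| variant_trans A B C : variant A B -> variant B C -> variant A C
| variant_neg A B : variant A B -> variant (Neg A) (Neg B)
| variant_box A B : variant A B -> variant (Box A) (Box B)
| variant_all x A B : variant A B -> variant (All x A) (All x B)
| variant_imp A B A' B' :
    variant A A' -> variant B B' -> variant (Imp A B) (Imp A' B').

Inductive axiom {Th : signature} : form Th -> Prop :=
| Ax1 A B : axiom (Imp A (Imp B A))
| Ax2 A B C :
    axiom (Imp (Imp A (Imp B C)) (Imp (Imp A B) (Imp A C)))
| Ax3 A B :
    axiom (Imp (Imp (Neg B) (Neg A)) (Imp (Imp (Neg B) A) B))
| Ax4 x u A : free_for u x A -> axiom (Imp (All x A) (subst x u A))
| Ax5 x A B :
    ~~ free_in x A -> axiom (Imp (All x (Imp A B)) (Imp A (All x B)))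
| Ax6 A B : variant A B -> axiom (Imp A B)
| Ax7 x : axiom (All x (Eqn (Var x) (Var x)))
| Ax8 x y A A' :
    free_for (Var y) x A -> frepl x y A A' ->
    axiom (Imp (Eqn (Var x) (Var y)) (Imp A A'))
| AxNeq x y : axiom (Imp (Eqn (Var x) (Var y)) (Box (Eqn (Var x) (Var y))))
| AxPeq x y :
    axiom (Imp (Neg (Eqn (Var x) (Var y))) (Box (Neg (Eqn (Var x) (Var y)))))
| AxK A B : axiom (Imp (Box (Imp A B)) (Imp (Box A) (Box B)))
| AxK1 A B : axiom (Imp (Box (Imp A B)) (Imp (Dia A) (Dia B)))
| AxK2 A B : axiom (Imp (Dia (Imp A B)) (Imp (Box A) (Dia B)))
| AxM1 A B : axiom (Imp (Box (Neg A)) (Box (Imp A B)))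
| AxM2 A B : axiom (Imp (Box B) (Box (Imp A B)))
| AxM3 A B : axiom (Imp (Dia B) (Dia (Imp A B)))
| AxM4 A B : axiom (Imp (Dia (Neg A)) (Dia (Imp A B)))
| AxT A : axiom (Imp (Box A) A)
| AxDN1 A : axiom (Imp (Box A) (Box (Neg (Neg A))))
| AxDN2 A : axiom (Imp (Box (Neg (Neg A))) (Box A))
| AxBF x A : axiom (Imp (All x (Box A)) (Box (All x A)))
| AxCBF x A : axiom (Imp (Box (All x A)) (All x (Box A)))
| AxNBF x A : axiom (Imp (All x (Dia A)) (Dia (All x A)))
| AxPBF x A : axiom (Imp (Dia (All x A)) (All x (Dia A))).

Definition justified {Th : signature} (G : set (form Th))
    (prev : seq (form Th)) (A : form Th) : Prop :=
  [\/ G A, axiom A,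
      exists B, List.In B prev /\ List.In (Imp B A) prev
    | exists x B, List.In B prev /\ A = All x B].

Definition derivation {Th : signature} (G : set (form Th))
    (s : seq (form Th)) : Prop :=
  forall s1 A s2, s = s1 ++ A :: s2 -> justified G s1 A.

Definition derives {Th : signature} (G : set (form Th)) (A : form Th) : Prop :=
  exists s, derivation G (rcons s A).

(* T+, C+, C-, F- *)
Inductive V4 : Type := Tp | Cp | Cm | Fm.

Definition designated : set V4 := [set Tp; Cp].

Definition mneg (a : V4) : set V4 :=
  match a with
  | Tp => [set Fm] | Cp => [set Cm] | Cm => [set Cp] | Fm => [set Tp]
  end.

Definition mbox (a : V4) : set V4 :=
  match a with Tp => [set Tp; Cp] | _ => [set Cm; Fm] end.

Definition mimp (a b : V4) : set V4 :=
  match a, b with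
  | Tp, Tp => [set Tp]
  | Tp, Cp => [set Cp]
  | Tp, Cm => [set Cm]
  | Tp, Fm => [set Fm]
  | Cp, Tp => [set Tp]
  | Cp, Cp => [set Tp; Cp]
  | Cp, Cm => [set Cm]
  | Cp, Fm => [set Cm]
  | Cm, Tp => [set Tp]
  | Cm, Cp => [set Tp; Cp]
  | Cm, Cm => [set Tp; Cp]
  | Cm, Fm => [set Cp]
  | Fm, _ => [set Tp]
  end.

Definition V4rank (a : V4) : nat :=
  match a with Fm => 0 | Cm => 1 | Cp => 2 | Tp => 3 end.

(* {min X} for the chain F- <= C- <= C+ <= T+ *)
Definition mall (X : set V4) : set V4 :=
  [set m | X m /\ forall a, X a -> V4rank m <= V4rank a].

Record structure (Th : signature) := Structure {
  dom : Type;
  dom_inhabited : inhabited dom;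
  apred : forall P : pred_sym Th, set (dom ^ par P);
  cpred : forall P : pred_sym Th, set (dom ^ par P);
  apred_ident : @apred (ident Th) = [set u | exists a, u = pair2 a a];
  cpred_ident : @cpred (ident Th) = set0;
  fint : forall f : fun_sym Th, (dom ^ far f)%type -> dom;
  cint : const_sym Th -> dom
}.

Arguments apred {Th} s P.
Arguments cpred {Th} s P.
Arguments fint {Th} s f.
Arguments cint {Th} s.

Definition assignment {Th : signature} (M : structure Th) : Type :=
  nat -> dom M.

Definition agree_off {Th : signature} {M : structure Th} (x : nat)
    (s : assignment M) : set (assignment M) :=
  [set s' | forall y, y != x -> s' y = s y].

Definition upd {Th : signature} {M : structure Th} (s : assignment M)
    (x : nat) (a : dom M) : assignment M :=
  fun y => if y == x then a else s y.

Fixpoint denot {Th : signature} {M : structure Th} (s : assignment M)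
    (t : term Th) : dom M :=
  match t with
  | Var x => s x
  | Cst c => cint M c
  | App f a => fint M f [ffun i => denot s (a i)]
  end.

Record valuation {Th : signature} (M : structure Th)
    (v : form Th -> assignment M -> V4) : Prop := Valuation {
  val_atom : forall P (a : (term Th ^ par P)%type) s,
    let u := [ffun i => denot s (a i)] in
    [/\ v (Atom P a) s = Tp <-> (apred M P `\` cpred M P) u,
        v (Atom P a) s = Cp <-> (apred M P `&` cpred M P) u,
        v (Atom P a) s = Cm <-> (cpred M P `\` apred M P) u
      & v (Atom P a) s = Fm <-> (~` (apred M P `|` cpred M P)) u];
  val_eqn : forall t1 t2 s,
    (v (Eqn t1 t2) s = Tp <-> denot s t1 = denot s t2) /\
    (v (Eqn t1 t2) s = Fm <-> denot s t1 <> denot s t2);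
  val_neg : forall A s, mneg (v A s) (v (Neg A) s);
  val_box : forall A s, mbox (v A s) (v (Box A) s);
  val_imp : forall A B s, mimp (v A s) (v B s) (v (Imp A B) s);
  val_all : forall x A s,
    mall [set v A s' | s' in agree_off x s] (v (All x A) s);
  val_subst : forall z t A s, free_for t z A ->
    v (subst z t A) s = v A (upd s z (denot s t));
  val_variant : forall A B s, variant A B -> v A s = v B s;
  val_repl : forall x y A A' s, free_for (Var y) x A -> frepl x y A A' ->
    designated (v (Imp (Eqn (Var x) (Var y)) (Imp A A')) s)
}.

Definition true_in {Th : signature} {M : structure Th}
    (v : form Th -> assignment M -> V4) (A : form Th) : Prop :=
  forall s, designated (v A s).

Definition entails {Th : signature} (G : set (form Th)) (A : form Th) : Prop :=
  forall (M : structure Th) (v : form Th -> assignment M -> V4),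
    valuation v -> (forall B, G B -> true_in v B) -> true_in v A.

(* Main.v *)
Require Import Defs.
From mathcomp Require Import all_boot.
From mathcomp Require Import classical_sets.
From mathcomp Require Import boolp.

(** The proof is Henkin's.  Suppose that [phi], or rather its universal closure
    [B], is not derivable from [G].  The set [G] extends to a theory [T] that
    does not derive [B], decides every sentence, and has for each sentence
    [All x A] a closed term [t] such that [A[x/t]] derives [All x A].  The value
    of a sentence [A] is then read off [T]: T+ if [Box A] is derivable, C+ if
    only [A] is, F- if [Box (Neg A)] is, and C- otherwise ([val]).  The modal
    axioms say exactly that this function respects the multioperations
    ([mneg_val], [mbox_val], [mimp_val]); the four Barcan axioms, together with
    the witnesses, make the value of [All x A] the minimum of the values of the
    instances ([mall_val]).  The domain of the model consists of representatives
    of the closed terms modulo derivable identity, and a formula is evaluated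
    under an assignment by substituting the representatives for its free
    variables ([term_val]).  Axioms (Ax6) and (Ax8) give the conditions on
    variants and on replacement, and (N=) and (P=) keep identities two-valued
    ([val_Eqn]).

    The signature may have uncountably many symbols, so variables cannot serve
    as witnesses, and new constants are needed.  For each sentence [All x A] of
    the extended language a constant [c] is added, with the axiom
    [A[x/c] -> All x A].  The language is thus self-referential, and the
    constants are taken to be finite trees which encode formulas: a formula has
    a larger code than the constants that occur in it.  Hence among finitely
    many of the new axioms there is always one whose constant occurs in no
    other; that constant can be replaced by a fresh variable ([prf_tr]), after
    which the axiom is an instance of the drinker principle and can be removed
    ([drinker_elim]).  So the new axioms are conservative
    ([henkin_conservative]), and Zorn's lemma completes the theory
    ([lindenbaum]).  The reduct of the term model to the original signature is
    the required countermodel. *)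

Set Implicit Arguments.
Unset Strict Implicit.
Unset Printing Implicit Defensive.

Local Open Scope classical_set_scope.

(** * Terms, bound variables and simultaneous substitution *)

(** The scheme generated for [term] gives no hypothesis on the arguments of
    [App], which sit inside a finite function. *)
Fixpoint term_args_ind (Th : signature) (P : term Th -> Prop)
    (hV : forall x, P (Var x)) (hC : forall c, P (Cst c))
    (hA : forall f (a : (term Th ^ far f)%type),
      (forall i, P (a i)) -> P (App f a)) (t : term Th) : P t :=
  match t with
  | Var x => hV x
  | Cst c => hC c
  | App f a => hA f a (fun i => term_args_ind hV hC hA (a i))
  end.

Definition closed_term {Th : signature} (t : term Th) : Prop :=
  forall x, ~~ occurs x t.

Definition closed {Th : signature} (A : form Th) : Prop :=
  forall x, ~~ free_in x A.

Lemma term_bound (Th : signature) (t : term Th) :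
  exists n, forall x, occurs x t -> x < n.
Proof.
elim/term_args_ind: t => [y|c|f a IH].
- by exists y.+1 => x /= /eqP <-.
- by exists 0.
- have [F hF] := choice IH.
  exists (\max_i F i) => x /= /existsP[i /hF hi].
  exact: leq_trans hi (leq_bigmax i).
Qed.

Lemma free_bound (Th : signature) (A : form Th) :
  exists n, forall x, free_in x A -> x < n.
Proof.
elim: A => [P a|A [n h]|A [n h]|y A [n h]|A [n h] B [m k]] /=.
- have [F hF] := choice (fun i => term_bound (a i)).
  exists (\max_i F i) => x /existsP[i /hF hi].
  exact: leq_trans hi (leq_bigmax i).
- by exists n.
- by exists n.
- by exists n => x /andP[_ /h].
- exists (maxn n m) => x; rewrite leq_max.
  by move=> /orP[/h ->|/k ->]; rewrite ?orbT.
Qed.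

Fixpoint binder_bound {Th : signature} (A : form Th) : nat :=
  match A with
  | Atom _ _ => 0
  | Neg B | Box B => binder_bound B
  | All y B => maxn y.+1 (binder_bound B)
  | Imp B C => maxn (binder_bound B) (binder_bound C)
  end.

Lemma free_for_unbound (Th : signature) (u : term Th) x (A : form Th) :
  (forall y, y < binder_bound A -> ~~ occurs y u) -> free_for u x A.
Proof.
elim: A => //= [y A IH|A IHA B IHB] h; last first.
  by rewrite IHA ?IHB // => y hy; apply: h; rewrite leq_max hy ?orbT.
rewrite h ?leq_max ?leqnn //= IH ?implybT // => z hz.
by apply: h; rewrite leq_max hz orbT.
Qed.

Lemma free_for_closed (Th : signature) (u : term Th) x (A : form Th) :
  closed_term u -> free_for u x A.
Proof. by move=> h; apply: free_for_unbound => y _. Qed.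

Lemma free_for_self (Th : signature) x (A : form Th) : free_for (Var x) x A.
Proof.
elim: A => //= [y A IH|A -> B ->] //.
by apply/implyP => /andP[]; rewrite eq_sym => ->.
Qed.

Definition upd_sub {Th : signature} (r : nat -> term Th) x u : nat -> term Th :=
  fun y => if y == x then u else r y.

Fixpoint ssubt {Th : signature} (r : nat -> term Th) (t : term Th) : term Th :=
  match t with
  | Var y => r y
  | Cst c => Cst c
  | App f a => App f [ffun i => ssubt r (a i)]
  end.

(** Simultaneous substitution is literal, like [subst]: variables of [r] may be
    captured.  It is meant for closed terms, the values of an assignment in a
    term model. *)
Fixpoint ssub {Th : signature} (r : nat -> term Th) (A : form Th) : form Th :=
  match A with
  | Atom P a => Atom P [ffun i => ssubt r (a i)]
  | Neg B => Neg (ssub r B)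
  | Box B => Box (ssub r B)
  | All y B => All y (ssub (upd_sub r y (Var y)) B)
  | Imp B C => Imp (ssub r B) (ssub r C)
  end.

Lemma upd_sub_eq (Th : signature) (r : nat -> term Th) x u :
  upd_sub r x u x = u.
Proof. by rewrite /upd_sub eqxx. Qed.

Lemma upd_sub_neq (Th : signature) (r : nat -> term Th) x u y :
  y != x -> upd_sub r x u y = r y.
Proof. by rewrite /upd_sub => /negbTE ->. Qed.

Lemma ssubt_ext (Th : signature) (r r' : nat -> term Th) t :
  (forall x, occurs x t -> r x = r' x) -> ssubt r t = ssubt r' t.
Proof.
elim/term_args_ind: t => //= [y|f a IH] h; first exact: h.
congr App; apply/ffunP => i; rewrite !ffunE; apply: IH => x hx.
by apply: h; apply/existsP; exists i.
Qed.

Lemma ssub_ext (Th : signature) (r r' : nat -> term Th) A :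
  (forall x, free_in x A -> r x = r' x) -> ssub r A = ssub r' A.
Proof.
elim: A r r' => [P a|A IH|A IH|y A IH|A IHA B IHB] r r' /= h.
- congr Atom; apply/ffunP => i; rewrite !ffunE; apply: ssubt_ext => x hx.
  by apply: h; apply/existsP; exists i.
- by rewrite (IH r r').
- by rewrite (IH r r').
- congr All; apply: IH => x hx; rewrite /upd_sub.
  by case: eqP => // /eqP nxy; apply: h; rewrite hx eq_sym nxy.
- by rewrite (IHA r r') ?(IHB r r') // => x hx; apply: h; rewrite hx ?orbT.
Qed.

Lemma upd_sub_id (Th : signature) x : upd_sub (@Var Th) x (Var x) = Var.
Proof. by apply/funext => y; rewrite /upd_sub; case: eqP => [->|]. Qed.

Lemma ssubt_id (Th : signature) (t : term Th) : ssubt Var t = t.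
Proof.
elim/term_args_ind: t => //= f a IH.
by congr App; apply/ffunP => i; rewrite ffunE.
Qed.

Lemma ssub_id (Th : signature) (A : form Th) : ssub Var A = A.
Proof.
elim: A => [P a|A IH|A IH|y A IH|A IHA B IHB] /=.
- by congr Atom; apply/ffunP => i; rewrite ffunE ssubt_id.
- by rewrite IH.
- by rewrite IH.
- by rewrite upd_sub_id IH.
- by rewrite IHA IHB.
Qed.

Lemma ssub_closed (Th : signature) (r : nat -> term Th) A :
  closed A -> ssub r A = A.
Proof.
move=> cA; rewrite -[RHS]ssub_id; apply: ssub_ext => x hx.
by move: (cA x); rewrite hx.
Qed.

Lemma tsubst_ssubt (Th : signature) x u (t : term Th) :
  tsubst x u t = ssubt (upd_sub Var x u) t.
Proof.
elim/term_args_ind: t => //= f a IH.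
by congr App; apply/ffunP => i; rewrite !ffunE.
Qed.

Lemma subst_ssub1 (Th : signature) x u (A : form Th) :
  subst x u A = ssub (upd_sub Var x u) A.
Proof.
elim: A => [P a|A IH|A IH|y A IH|A IHA B IHB] /=.
- by congr Atom; apply/ffunP => i; rewrite !ffunE tsubst_ssubt.
- by rewrite IH.
- by rewrite IH.
- case: eqP => [->|/eqP nyx]; congr All.
    rewrite -[LHS]ssub_id; apply: ssub_ext => z _; rewrite /upd_sub.
    by case: eqP => [->|].
  rewrite IH; apply: ssub_ext => z _; rewrite /upd_sub.
  by case: (z =P y) => // ->; rewrite (negbTE nyx).
- by rewrite IHA IHB.
Qed.

Lemma subst_self (Th : signature) x (A : form Th) : subst x (Var x) A = A.
Proof. by rewrite subst_ssub1 upd_sub_id ssub_id. Qed.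

Lemma tsubst_notin (Th : signature) x u (t : term Th) :
  ~~ occurs x t -> tsubst x u t = t.
Proof.
move=> h; rewrite tsubst_ssubt -[RHS]ssubt_id; apply: ssubt_ext => y hy.
by rewrite upd_sub_neq //; apply: contraNneq h => <-.
Qed.

Lemma occurs_ssubt (Th : signature) (r : nat -> term Th) x t :
  (forall y, occurs y t -> ~~ occurs x (r y)) -> ~~ occurs x (ssubt r t).
Proof.
elim/term_args_ind: t => //= [y h|f a IH h]; first exact: h.
rewrite negb_exists; apply/forallP => i; rewrite ffunE; apply: IH => y hy.
by apply: h; apply/existsP; exists i.
Qed.

Lemma free_in_ssub (Th : signature) (r : nat -> term Th) x A :
  (forall y, free_in y A -> ~~ occurs x (r y)) -> ~~ free_in x (ssub r A).
Proof.
elim: A r => [P a|A IH|A IH|z A IH|A IHA B IHB] r /= h.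
- rewrite negb_exists; apply/forallP => i; rewrite ffunE.
  apply: occurs_ssubt => y hy; apply: h; apply/existsP; by exists i.
- exact: IH.
- exact: IH.
- have [//|nzx] /= := eqVneq z x.
  apply: IH => y hy; rewrite /upd_sub; case: eqP => [//|/eqP nyz].
  by apply: h; rewrite eq_sym nyz.
- by rewrite negb_or IHA ?IHB // => y hy; apply: h; rewrite hy ?orbT.
Qed.

Lemma closed_ssubt (Th : signature) (r : nat -> term Th) t :
  (forall y, closed_term (r y)) -> closed_term (ssubt r t).
Proof. by move=> h x; apply: occurs_ssubt => y _; apply: h. Qed.

Lemma closed_ssub (Th : signature) (r : nat -> term Th) A :
  (forall y, closed_term (r y)) -> closed (ssub r A).
Proof. by move=> h x; apply: free_in_ssub => y _; apply: h. Qed.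

Lemma tsubst_ssub (Th : signature) x u (r : nat -> term Th) t :
  tsubst x u (ssubt r t) = ssubt (fun y => tsubst x u (r y)) t.
Proof.
elim/term_args_ind: t => //= f a IH.
by congr App; apply/ffunP => i; rewrite !ffunE.
Qed.

Lemma subst_ssub (Th : signature) x u (r : nat -> term Th) A :
  (forall y, y != x -> ~~ occurs x (r y)) ->
  subst x u (ssub r A) = ssub (fun y => tsubst x u (r y)) A.
Proof.
elim: A r => [P a|A IH|A IH|z A IH|A IHA B IHB] r /= h.
- by congr Atom; apply/ffunP => i; rewrite !ffunE tsubst_ssub.
- by rewrite IH.
- by rewrite IH.
- case: eqP => [->|/eqP nzx]; congr All.
    apply: ssub_ext => y _; rewrite /upd_sub; case: eqP => // /eqP nyx.
    by rewrite tsubst_notin ?h.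
  rewrite IH => [|y nyx].
    apply: ssub_ext => y _; rewrite /upd_sub.
    by case: (y =P z) => //=; rewrite (negbTE nzx).
  by rewrite /upd_sub; case: eqP => //= _; apply: h.
- by rewrite IHA // IHB.
Qed.

Lemma ssubt_tsubst (Th : signature) x u (r : nat -> term Th) t :
  ssubt r (tsubst x u t) = ssubt (upd_sub r x (ssubt r u)) t.
Proof.
elim/term_args_ind: t => //= [y|f a IH].
  by rewrite /upd_sub; case: eqP.
by congr App; apply/ffunP => i; rewrite !ffunE.
Qed.

(** The binders of [A] above a free occurrence of [x] bind no variable of [u],
    so resetting [r] at them does not change the value of [u]. *)
Lemma ssub_subst (Th : signature) x u (r : nat -> term Th) A :
  free_for u x A -> ssub r (subst x u A) = ssub (upd_sub r x (ssubt r u)) A.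
Proof.
elim: A r => [P a|A IH|A IH|z A IH|A IHA B IHB] r /= h.
- by congr Atom; apply/ffunP => i; rewrite !ffunE ssubt_tsubst.
- by rewrite IH.
- by rewrite IH.
- have [->|nzx] := eqVneq z x.
    rewrite /=; congr All; apply: ssub_ext => y _.
    by rewrite /upd_sub; case: eqP.
  rewrite /=; congr All; case xA: (free_in x A); last first.
    rewrite subst_ssub1 (@ssub_ext _ (upd_sub Var x u) Var) ?ssub_id.
      apply: ssub_ext => y yA; rewrite /upd_sub; case: (y =P z) => // _.
      by case: eqP => // eyx; rewrite -eyx yA in xA.
    move=> y yA; rewrite upd_sub_neq //.
    by apply: contraTneq yA => ->; rewrite xA.
  move: h; rewrite nzx xA /= => /andP[zu fu]; rewrite IH //.
  apply: ssub_ext => y _; rewrite /upd_sub.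
  case: (y =P x) => [->|_]; last by [].
  rewrite eq_sym (negbTE nzx); apply: ssubt_ext => w wu.
  by case: eqP => // ewz; rewrite -ewz wu in zu.
- by case/andP: h => hA hB; rewrite IHA // IHB.
Qed.

(** * The Hilbert calculus *)

(** Derivability as an inductive predicate, which allows induction on
    derivations. *)
Inductive prf {Th : signature} (G : set (form Th)) : form Th -> Prop :=
| prf_hyp A : G A -> prf G A
| prf_ax A : Defs.axiom A -> prf G A
| prf_mp A B : prf G B -> prf G (Imp B A) -> prf G A
| prf_gen x A : prf G A -> prf G (All x A).

Lemma justified_sub (Th : signature) (G : set (form Th)) s s' A :
  (forall B, List.In B s -> List.In B s') ->
  justified G s A -> justified G s' A.
Proof.
move=> ss' [h|h|[B [h1 h2]]|[x [B [h1 h2]]]].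
- exact: Or41.
- exact: Or42.
- by apply: Or43; exists B; split; apply: ss'.
- by apply: Or44; exists x, B; split; first exact: ss'.
Qed.

Lemma derivation_rcons (Th : signature) (G : set (form Th)) s A :
  derivation G s -> justified G s A -> derivation G (rcons s A).
Proof.
move=> hs hA s1 B s2; case/lastP: s2 => [|s2 C].
  by rewrite cats1 => /rcons_inj[<- <-].
by rewrite -rcons_cons -rcons_cat => /rcons_inj[/hs].
Qed.

Lemma derivation_cat (Th : signature) (G : set (form Th)) s s' :
  derivation G s -> derivation G s' -> derivation G (s ++ s').
Proof.
move=> hs; elim/last_ind: s' => [|s' A IH] hs'; first by rewrite cats0.
rewrite -rcons_cat; apply: derivation_rcons.
  apply: IH => s1 B s2 e; apply: (hs' s1 B (rcons s2 A)).
  by rewrite e -rcons_cons -rcons_cat.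
apply: (@justified_sub _ _ s') => [B hB|]; first by apply/List.in_or_app; right.
by apply: (hs' _ _ [::]); rewrite cats1.
Qed.

Lemma prf_derives (Th : signature) (G : set (form Th)) A :
  prf G A -> derives G A.
Proof.
have nilD : derivation G [::] by case.
have InR (s : seq (form Th)) B : List.In B (rcons s B).
  by rewrite -cats1; apply/List.in_or_app; right; left.
elim=> {A} [A hA|A hA|A B _ [s hs] _ [s' hs']|x A _ [s hs]].
- by exists [::]; apply: derivation_rcons => //; apply: Or41.
- by exists [::]; apply: derivation_rcons => //; apply: Or42.
- exists (rcons s B ++ rcons s' (Imp B A)); apply: derivation_rcons.
    exact: derivation_cat.
  by apply: Or43; exists B; split; apply/List.in_or_app; [left|right].
- exists (rcons s A); apply: derivation_rcons => //.
  by apply: Or44; exists x, A.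
Qed.

Lemma prf_sub (Th : signature) (G G' : set (form Th)) A :
  G `<=` G' -> prf G A -> prf G' A.
Proof.
move=> sG; elim=> {A} [A /sG|A|A B _ hB _|x A _]; first exact: prf_hyp.
- exact: prf_ax.
- exact: prf_mp.
- exact: prf_gen.
Qed.

Lemma prf_ax_mp (Th : signature) (G : set (form Th)) A B :
  Defs.axiom (Imp A B) -> prf G A -> prf G B.
Proof. by move=> h hA; apply: (prf_mp hA); apply: prf_ax. Qed.

Lemma prf_weak (Th : signature) (G : set (form Th)) A B :
  prf G B -> prf G (Imp A B).
Proof. by apply: prf_ax_mp; apply: Ax1. Qed.

Lemma prf_mp2 (Th : signature) (G : set (form Th)) A B C :
  prf G (Imp A (Imp B C)) -> prf G (Imp A B) -> prf G (Imp A C).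
Proof.
move=> h1 h2; apply: (prf_mp h2); apply: (prf_mp h1).
by apply: prf_ax; apply: Ax2.
Qed.

Lemma prf_trans (Th : signature) (G : set (form Th)) A B C :
  prf G (Imp A B) -> prf G (Imp B C) -> prf G (Imp A C).
Proof. by move=> h1 h2; apply: prf_mp2 h1; apply: prf_weak. Qed.

Lemma prf_refl (Th : signature) (G : set (form Th)) A : prf G (Imp A A).
Proof.
apply: (@prf_mp2 _ _ _ (Imp A A)); apply: prf_ax; exact: Ax1.
Qed.

Lemma prf_exfalso (Th : signature) (G : set (form Th)) A B :
  prf G (Imp (Neg A) (Imp A B)).
Proof.
have h : prf G (Imp (Neg A) (Imp (Imp (Neg B) A) B)).
  apply: (@prf_trans _ _ _ (Imp (Neg B) (Neg A))); apply: prf_ax.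
    exact: Ax1.
  exact: Ax3.
apply: (prf_trans h); apply: prf_mp2 (prf_weak _ (prf_ax _ (Ax1 A (Neg B)))).
apply: (@prf_trans _ _ _ (Imp A (Imp (Imp (Neg B) A) B))); apply: prf_ax.
  exact: Ax1.
exact: Ax2.
Qed.

Lemma prf_contra (Th : signature) (G : set (form Th)) A B :
  prf G (Imp (Neg A) B) -> prf G (Imp (Neg B) A).
Proof.
move=> h; apply: prf_mp2 (prf_weak _ h).
apply: (@prf_trans _ _ _ (Imp (Neg A) (Neg B))); apply: prf_ax.
  exact: Ax1.
exact: Ax3.
Qed.

Lemma prf_clavius (Th : signature) (G : set (form Th)) A :
  prf G (Imp (Neg A) A) -> prf G A.
Proof.
move=> h; apply: (prf_mp h); apply: (prf_mp (prf_refl _ (Neg A))).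
by apply: prf_ax; apply: Ax3.
Qed.

Lemma prf_cases (Th : signature) (G : set (form Th)) A B :
  prf G (Imp A B) -> prf G (Imp (Neg A) B) -> prf G B.
Proof.
by move=> h1 h2; apply: prf_clavius; apply: prf_trans h1; apply: prf_contra.
Qed.

(** The hypothesis [S] must be closed: (Gen) applies to premises, and only then
    does (Ax5) carry a generalisation over the implication. *)
Lemma deduction (Th : signature) (G : set (form Th)) S A :
  closed S -> prf (G `|` [set S]) A -> prf G (Imp S A).
Proof.
move=> cS; elim=> {A} [A [h| ->]|A h|A B _ hB _ hBA|x A _ hA].
- by apply: prf_weak; apply: prf_hyp.
- exact: prf_refl.
- by apply: prf_weak; apply: prf_ax.
- exact: prf_mp2 hBA hB.
- by apply: (prf_mp (prf_gen x hA)); apply: prf_ax; apply: Ax5.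
Qed.

Lemma prf_subst (Th : signature) (G : set (form Th)) x u A :
  free_for u x A -> prf G A -> prf G (subst x u A).
Proof.
by move=> h hA; apply: (prf_mp (prf_gen x hA)); apply: prf_ax; apply: Ax4.
Qed.

(** Closed terms do not contain the variables still to be replaced, so a
    simultaneous substitution may be performed one variable at a time. *)
Lemma prf_ssub (Th : signature) (G : set (form Th)) (r : nat -> term Th) A :
  (forall y, closed_term (r y)) -> prf G A -> prf G (ssub r A).
Proof.
move=> cr hA; pose q n y := if y < n then r y else Var y.
have hq n : prf G (ssub (q n) A).
  elim: n => [|n IH]; first by rewrite ssub_id.
  have -> : ssub (q n.+1) A = subst n (r n) (ssub (q n) A).
    rewrite subst_ssub => [|y nyn]; last first.
      by rewrite /q; case: ifP => _; [exact: cr|].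
    apply: ssub_ext => y _; rewrite /q ltnS leq_eqVlt.
    have [->|nyn] := eqVneq; first by rewrite /= ltnn /= eqxx.
    by case: ltnP => _ /=; rewrite ?tsubst_notin ?(negbTE nyn) //; apply: cr.
  by apply: prf_subst => //; apply: free_for_closed.
have [n hn] := free_bound A.
by rewrite (@ssub_ext _ _ (q n)) // => x /hn xn; rewrite /q xn.
Qed.

Fixpoint closure {Th : signature} (n : nat) (A : form Th) : form Th :=
  if n is m.+1 then All m (closure m A) else A.

Lemma free_in_closure (Th : signature) n (A : form Th) x :
  free_in x (closure n A) = (n <= x) && free_in x A.
Proof.
elim: n => //= n ->; rewrite andbA; congr (_ && _).
by rewrite ltn_neqAle.
Qed.

Lemma exists_closure (Th : signature) (A : form Th) :
  exists n, closed (closure n A).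
Proof.
have [n h] := free_bound A; exists n => x.
by rewrite free_in_closure; apply/andP => -[nx /h]; rewrite ltnNge nx.
Qed.

Lemma prf_closure (Th : signature) (G : set (form Th)) n A :
  prf G (closure n A) <-> prf G A.
Proof.
elim: n => //= n <-; split; last exact: prf_gen.
move=> h; apply: (prf_mp h); rewrite -{2}(subst_self n (closure n A)).
by apply: prf_ax; apply: Ax4; apply: free_for_self.
Qed.

(** * Changing the constants of a signature *)

Definition with_consts (Th : signature) (K : Type) : signature :=
  @Signature (pred_sym Th) (@par Th) (@par_gt0 Th) (ident Th) (@par_ident Th)
    (fun_sym Th) (@far Th) (@far_gt0 Th) K.

(** Constants may go to variables as well as to constants: this covers both the
    embedding of a language into a larger one and the elimination of constants
    from a derivation. *)
Fixpoint trt {Th : signature} {K L : Type} (g : K -> L + nat)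
    (t : term (with_consts Th K)) : term (with_consts Th L) :=
  match t with
  | Var y => Var y
  | Cst k => match g k with
             | inl c => Cst (c : const_sym (with_consts Th L))
             | inr y => Var y
             end
  | App f a =>
      @App (with_consts Th L) f [ffun i : 'I_(@far Th f) => trt g (a i)]
  end.

Fixpoint tr {Th : signature} {K L : Type} (g : K -> L + nat)
    (A : form (with_consts Th K)) : form (with_consts Th L) :=
  match A with
  | Atom P a =>
      @Atom (with_consts Th L) P [ffun i : 'I_(@par Th P) => trt g (a i)]
  | Neg B => Neg (tr g B)
  | Box B => Box (tr g B)
  | All y B => All y (tr g B)
  | Imp B C => Imp (tr g B) (tr g C)
  end.

Definition vars_ge {K L : Type} (n : nat) (g : K -> L + nat) : Prop :=
  forall k y, g k = inr y -> n <= y.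

Lemma vars_ge_le (K L : Type) m n (g : K -> L + nat) :
  m <= n -> vars_ge n g -> vars_ge m g.
Proof. by move=> mn h k y /h; apply: leq_trans. Qed.

Lemma tr_id (Th : signature) (K L : Type) (f : K -> L + nat)
    (g : L -> K + nat) (A : form (with_consts Th K)) :
  (forall k, exists2 c, f k = inl c & g c = inl k) -> tr g (tr f A) = A.
Proof.
move=> h; have ht (t : term (with_consts Th K)) : trt g (trt f t) = t.
  elim/term_args_ind: t => //= [k|F a IH].
    by have [c -> /= ->] := h k.
  by congr App; apply/ffunP => i; rewrite !ffunE.
elim: A => [P a|A IH|A IH|y A IH|A IHA B IHB] /=; rewrite ?IH ?IHA ?IHB //.
by congr Atom; apply/ffunP => i; rewrite !ffunE.
Qed.

Lemma occurs_trt (Th : signature) (K L : Type) (g : K -> L + nat) x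
    (t : term (with_consts Th K)) :
  vars_ge x.+1 g -> occurs x (trt g t) = occurs x t.
Proof.
move=> hg; elim/term_args_ind: t => //= [k|F a IH].
  case e: (g k) => [c|y] //=; apply/negbTE.
  by rewrite neq_ltn (hg _ _ e) orbT.
by apply: eq_existsb => i; rewrite ffunE.
Qed.

Lemma free_in_tr (Th : signature) (K L : Type) (g : K -> L + nat) x
    (A : form (with_consts Th K)) :
  vars_ge x.+1 g -> free_in x (tr g A) = free_in x A.
Proof.
move=> hg; elim: A => [P a|A IH|A IH|y A IH|A IHA B IHB] /=;
  rewrite ?IH ?IHA ?IHB //.
by apply: eq_existsb => i; rewrite ffunE occurs_trt.
Qed.

Lemma trt_tsubst (Th : signature) (K L : Type) (g : K -> L + nat) x u
    (t : term (with_consts Th K)) :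
  vars_ge x.+1 g -> trt g (tsubst x u t) = tsubst x (trt g u) (trt g t).
Proof.
move=> hg; elim/term_args_ind: t => //= [y|k|F a IH].
- by case: eqP.
- case e: (g k) => [c|y] //=; case: eqP => // exy.
  by have := hg _ _ e; rewrite exy ltnn.
- by congr App; apply/ffunP => i; rewrite !ffunE.
Qed.

Lemma tr_subst (Th : signature) (K L : Type) (g : K -> L + nat) x u
    (A : form (with_consts Th K)) :
  vars_ge x.+1 g -> tr g (subst x u A) = subst x (trt g u) (tr g A).
Proof.
move=> hg; elim: A => [P a|A IH|A IH|y A IH|A IHA B IHB] /=;
  rewrite ?IH ?IHA ?IHB //.
  by congr Atom; apply/ffunP => i; rewrite !ffunE trt_tsubst.
by case: eqP => //= _; rewrite IH.
Qed.

Lemma free_for_tr (Th : signature) (K L : Type) (g : K -> L + nat) x u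
    (A : form (with_consts Th K)) :
  vars_ge x.+1 g -> vars_ge (binder_bound A) g ->
  free_for u x A -> free_for (trt g u) x (tr g A).
Proof.
move=> hx; elim: A => [P a|A IH|A IH|y A IH|A IHA B IHB] //= hA.
- have hy : vars_ge y.+1 g by apply: vars_ge_le hA; rewrite leq_maxl.
  rewrite free_in_tr // occurs_trt // => /implyP h.
  apply/implyP => /h /andP[-> fA]; apply: IH fA.
  by apply: vars_ge_le hA; rewrite leq_maxr.
- case/andP=> fA fB.
  by rewrite IHA ?IHB //; apply: vars_ge_le hA; rewrite ?leq_maxr ?leq_maxl.
Qed.

Lemma tr_Eqn (Th : signature) (K L : Type) (g : K -> L + nat)
    (t u : term (with_consts Th K)) :
  tr g (Eqn t u) = Eqn (trt g t) (trt g u).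
Proof.
by rewrite /Eqn /=; congr Atom; apply/ffunP => i; rewrite !ffunE; case: ifP.
Qed.

Lemma trepl_trt (Th : signature) (K L : Type) (g : K -> L + nat) x y
    (t t' : term (with_consts Th K)) :
  trepl x y t t' -> trepl x y (trt g t) (trt g t').
Proof.
elim=> {t t'} [t||F a b _ IH] /=; try by constructor.
by apply: trepl_app => i; rewrite !ffunE.
Qed.

Lemma frepl_tr (Th : signature) (K L : Type) (g : K -> L + nat) x y
    (A A' : form (with_consts Th K)) :
  frepl x y A A' -> frepl x y (tr g A) (tr g A').
Proof.
elim=> {A A'} [A|P a b h|A B _|A B _|z A B nzx _|A B A' B' _ h1 _ h2] /=;
  try by constructor.
by apply: frepl_atom => i; rewrite !ffunE; apply: trepl_trt.
Qed.

(** The bound [n] has to exceed the variables of all the formulas on the way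
    from [A] to [B], not only those of [A] and [B]. *)
Lemma variant_tr (Th : signature) (K L : Type)
    (A B : form (with_consts Th K)) :
  variant A B ->
  exists n, forall g : K -> L + nat, vars_ge n g -> variant (tr g A) (tr g B).
Proof.
elim=> {A B} [x A xA|x y A yA fA|A|A B _ [n h]|A B C _ [n h] _ [m k]|
  A B _ [n h]|A B _ [n h]|x A B _ [n h]|A B A' B' _ [n h] _ [m k]].
- exists x.+1 => g hg /=; apply: variant_void.
  by rewrite free_in_tr.
- exists (maxn (maxn x.+1 y.+1) (binder_bound A)) => g.
  move=> hg /=; have hx : vars_ge x.+1 g.
    by apply: vars_ge_le hg; rewrite !leq_max leqnn.
  have hy : vars_ge y.+1 g by apply: vars_ge_le hg; rewrite !leq_max leqnn orbT.
  rewrite tr_subst //; apply: variant_rename; first by rewrite free_in_tr.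
  have := @free_for_tr _ _ _ g x (Var y) A hx; apply=> //.
  by apply: vars_ge_le hg; rewrite !leq_max leqnn orbT.
- by exists 0 => g _; apply: variant_refl.
- by exists n => g /h; apply: variant_sym.
- exists (maxn n m) => g hg; apply: variant_trans (h g _) (k g _);
    by apply: vars_ge_le hg; rewrite ?leq_maxl ?leq_maxr.
- by exists n => g /h; apply: variant_neg.
- by exists n => g /h; apply: variant_box.
- by exists n => g /h; apply: variant_all.
- exists (maxn n m) => g hg; apply: variant_imp (h g _) (k g _);
    by apply: vars_ge_le hg; rewrite ?leq_maxl ?leq_maxr.
Qed.

Lemma axiom_tr (Th : signature) (K L : Type) (A : form (with_consts Th K)) :
  Defs.axiom A ->
  exists n, forall g : K -> L + nat, vars_ge n g -> Defs.axiom (tr g A).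
Proof.
pose e x y : form (with_consts Th K) := Eqn (Var x) (Var y).
case=> {A} [A B|A B C|A B|x u A h|x A B h|A B h|x|x y A A' h h'|x y|x y|
  A B|A B|A B|A B|A B|A B|A B|A|A|A|x A|x A|x A|x A];
  try by (exists 0 => g _ /=; constructor).
- exists (maxn x.+1 (binder_bound A)) => g hg /=.
  have hx : vars_ge x.+1 g by apply: vars_ge_le hg; rewrite leq_maxl.
  rewrite tr_subst //; apply: Ax4; apply: free_for_tr => //.
  by apply: vars_ge_le hg; rewrite leq_maxr.
- by exists x.+1 => g hg /=; apply: Ax5; rewrite free_in_tr.
- have [n hn] := variant_tr L h.
  by exists n => g /hn hg /=; apply: Ax6.
- exists 0 => g _; change (Defs.axiom (All x (tr g (e x x)))).
  by rewrite /e tr_Eqn; apply: Ax7.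
- exists (maxn x.+1 (binder_bound A)) => g hg.
  change (Defs.axiom
    (Imp (tr g (e x y)) (Imp (tr g A) (tr g A')))).
  rewrite /e tr_Eqn; apply: Ax8; last exact: frepl_tr.
  apply: (@free_for_tr _ _ _ g x (Var y)) => //; apply: vars_ge_le hg;
    by rewrite ?leq_maxl ?leq_maxr.
- exists 0 => g _.
  change (Defs.axiom (Imp (tr g (e x y)) (Box (tr g (e x y))))).
  by rewrite /e tr_Eqn; apply: AxNeq.
- exists 0 => g _.
  change (Defs.axiom (Imp (Neg (tr g (e x y))) (Box (Neg (tr g (e x y)))))).
  by rewrite /e tr_Eqn; apply: AxPeq.
Qed.

(** In a derivation, a constant behaves as a variable that is mentioned nowhere:
    the side conditions of the axioms speak only of variables that occur in
    them, and fresh variables, like constants, never violate these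
    conditions. *)
Lemma prf_tr (Th : signature) (K L : Type) (G : set (form (with_consts Th K)))
    (A : form (with_consts Th K)) :
  prf G A ->
  exists n, forall g : K -> L + nat, vars_ge n g -> prf (tr g @` G) (tr g A).
Proof.
elim=> {A} [A hA|A hA|A B _ [n h] _ [m k]|x A _ [n h]].
- by exists 0 => g _; apply: prf_hyp; exists A.
- have [n hn] := axiom_tr L hA; exists n => g /hn; exact: prf_ax.
- exists (maxn n m) => g hg; apply: prf_mp (h g _) (k g _);
    by apply: vars_ge_le hg; rewrite ?leq_maxl ?leq_maxr.
- by exists n => g /h; apply: prf_gen.
Qed.

(** * Witness constants and the Henkin axioms *)

Inductive label (Th : signature) (K : Type) : Type :=
| LVar of nat
| LCst of K
| LWit
| LFun of fun_sym Th
| LPred of pred_sym Th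
| LNeg
| LBox
| LAll of nat
| LImp.

Arguments LVar {Th K}.
Arguments LCst {Th K}.
Arguments LWit {Th K}.
Arguments LFun {Th K}.
Arguments LPred {Th K}.
Arguments LNeg {Th K}.
Arguments LBox {Th K}.
Arguments LAll {Th K}.
Arguments LImp {Th K}.

(** The witness constants are trees, so that they may encode formulas in which
    witness constants occur, without a circular definition of the signature. *)
Inductive code (Th : signature) (K : Type) : Type :=
  Node of label Th K & seq (code Th K).

Fixpoint code_size {Th : signature} {K : Type} (c : code Th K) : nat :=
  let: Node _ s := c in (sumn (map code_size s)).+1.

Definition henkin_sig (Th : signature) (K : Type) : signature :=
  with_consts Th (K + code Th K).

Fixpoint enc_term {Th : signature} {K : Type} (t : term (henkin_sig Th K)) :
    code Th K :=
  match t with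
  | Var x => Node (LVar x) [::]
  | Cst (inl k) => Node (LCst k) [::]
  | Cst (inr c) => Node LWit [:: c]
  | App f a => Node (LFun (f : fun_sym Th))
      [seq enc_term (a i) | i <- enum 'I_(far f)]
  end.

Fixpoint enc {Th : signature} {K : Type} (A : form (henkin_sig Th K)) :
    code Th K :=
  match A with
  | Atom P a => Node (LPred (P : pred_sym Th))
      [seq enc_term (a i) | i <- enum 'I_(par P)]
  | Neg B => Node LNeg [:: enc B]
  | Box B => Node LBox [:: enc B]
  | All x B => Node (LAll x) [:: enc B]
  | Imp B C => Node LImp [:: enc B; enc C]
  end.

Lemma enc_term_inj (Th : signature) (K : Type) :
  injective (@enc_term Th K).
Proof.
elim/term_args_ind => [x|[k|c]|f a IH] [y|[l|d]|h b] //= [].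
- by move=> ->.
- by move=> ->.
- by move=> ->.
- move=> efh; case: h / efh b => b /eq_in_map e.
  by congr App; apply/ffunP => i; apply: IH; apply: e; rewrite mem_enum.
Qed.

Lemma enc_inj (Th : signature) (K : Type) : injective (@enc Th K).
Proof.
elim=> [P a|A IH|A IH|x A IH|A IHA B IHB] [Q b|C|C|y C|C D] //= [].
- move=> ePQ; case: Q / ePQ b => b /eq_in_map e.
  congr Atom; apply/ffunP => i; apply: enc_term_inj.
  by apply: e; rewrite mem_enum.
- by move=> /IH ->.
- by move=> /IH ->.
- by move=> -> /IH ->.
- by move=> /IHA -> /IHB ->.
Qed.

(** By its Henkin axiom this constant names a counterexample to [All x A], if
    there is one. *)
Definition witness {Th : signature} {K : Type} (x : nat)
    (A : form (henkin_sig Th K)) : term (henkin_sig Th K) :=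
  Cst (inr (enc (All x A)) : const_sym (henkin_sig Th K)).

Definition henkin {Th : signature} {K : Type}
    (p : nat * form (henkin_sig Th K)) : form (henkin_sig Th K) :=
  Imp (subst p.1 (witness p.1 p.2) p.2) (All p.1 p.2).

Definition embed {Th : signature} {K : Type} :
    form (with_consts Th K) -> form (henkin_sig Th K) :=
  tr (fun k => inl (inl k)).

Definition const_to_var {Th : signature} {K : Type} (c : code Th K) (y : nat)
    (k : K + code Th K) : (K + code Th K) + nat :=
  if `[< k = inr c >] then inr y else inl k.

Lemma vars_ge_const_to_var (Th : signature) (K : Type) (c : code Th K) n y :
  n <= y -> vars_ge n (const_to_var c y).
Proof. by move=> ny k z; rewrite /const_to_var; case: ifP => // _ [<-]. Qed.

Lemma code_size_mem (Th : signature) (K : Type) (I : eqType) (s : seq I)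
    (F : I -> code Th K) i :
  i \in s -> code_size (F i) <= sumn (map code_size (map F s)).
Proof.
elim: s => //= j s IH; rewrite inE => /orP[/eqP ->|/IH h].
  exact: leq_addr.
exact: leq_trans h (leq_addl _ _).
Qed.

(** A code is larger than the codes of the witness constants that occur in the
    formula that it encodes. *)
Lemma tr_const_to_var_small (Th : signature) (K : Type) (c : code Th K) y
    (A : form (henkin_sig Th K)) :
  code_size (enc A) <= code_size c -> tr (const_to_var c y) A = A.
Proof.
have ht (t : term (henkin_sig Th K)) :
    code_size (enc_term t) <= code_size c -> trt (const_to_var c y) t = t.
  elim/term_args_ind: t => //= [[k|d] h|f a IH h].
  - by rewrite /const_to_var asboolF.
  - rewrite /const_to_var asboolF // => -[edc].
    by move: h; rewrite edc /= addn0 ltnn.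
  - congr App; apply/ffunP => i; rewrite ffunE; apply: IH.
    apply: leq_trans h; apply: leqW.
    by apply: (code_size_mem (fun i => enc_term (a i))); rewrite mem_enum.
elim: A => [P a|A IH|A IH|x A IH|A IHA B IHB] /= h.
- congr Atom; apply/ffunP => i; rewrite ffunE; apply: ht.
  apply: leq_trans h; apply: leqW.
  by apply: (code_size_mem (fun i => enc_term (a i))); rewrite mem_enum.
- by rewrite IH //; apply: leq_trans h; rewrite addn0.
- by rewrite IH //; apply: leq_trans h; rewrite addn0.
- by rewrite IH //; apply: leq_trans h; rewrite addn0.
- rewrite IHA ?IHB //; apply: leq_trans h; rewrite addn0 leqW //.
    exact: leq_addl.
  exact: leq_addr.
Qed.

Lemma tr_const_to_var_embed (Th : signature) (K : Type) (c : code Th K) y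
    (A : form (with_consts Th K)) :
  tr (const_to_var c y) (embed A) = embed A.
Proof.
have ht (t : term (with_consts Th K)) :
    trt (const_to_var c y) (trt (fun k => inl (inl k)) t) =
    trt (fun k => inl (inl k : K + code Th K)) t.
  elim/term_args_ind: t => //= [k|f a IH].
    by rewrite /const_to_var asboolF.
  by congr App; apply/ffunP => i; rewrite !ffunE.
rewrite /embed; elim: A => [P a|A IH|A IH|x A IH|A IHA B IHB] /=;
  rewrite ?IH ?IHA ?IHB //.
by congr Atom; apply/ffunP => i; rewrite !ffunE.
Qed.

(** With the variable [y] in place of its constant, a Henkin axiom has no
    consequence without [y] that was not derivable before: if [B] fails then so
    does the axiom, so that [A] holds at [y]; then [All x A] holds, and with it
    the axiom. *)
Lemma drinker_elim (Th : signature) (G : set (form Th)) x y A B :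
  ~~ free_in y A -> free_for (Var y) x A -> ~~ free_in y B ->
  prf G (Imp (Imp (subst x (Var y) A) (All x A)) B) -> prf G B.
Proof.
move=> yA fA yB h; apply: prf_clavius.
have hall : prf G (Imp (All x A) B).
  by apply: prf_trans h; apply: prf_ax; apply: Ax1.
apply: prf_trans hall.
have hy : prf G (Imp (Neg B) (subst x (Var y) A)).
  by apply: prf_contra; apply: prf_trans h; apply: prf_exfalso.
apply: (@prf_trans _ _ _ (All y (subst x (Var y) A))).
  by apply: (prf_mp (prf_gen y hy)); apply: prf_ax; apply: Ax5.
by apply: prf_ax; apply: Ax6; apply: variant_sym; apply: variant_rename.
Qed.

Lemma closed_henkin (Th : signature) (K : Type)
    (p : nat * form (henkin_sig Th K)) :
  closed (All p.1 p.2) -> closed (henkin p).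
Proof.
case: p => x A /= cA z /=; rewrite negb_or cA andbT subst_ssub1.
apply: free_in_ssub => y yA; rewrite /upd_sub; case: eqP => //= /eqP nyx.
by have := cA y; rewrite /= yA eq_sym nyx.
Qed.

(** Among finitely many Henkin axioms, the constant of one with the largest code
    occurs in no other.  It can be replaced by a fresh variable. *)
Lemma henkin_elim (Th : signature) (K : Type)
    (G : set (form (with_consts Th K))) (B : form (henkin_sig Th K))
    (ps : seq {classic nat * form (henkin_sig Th K)}) :
  closed B -> (forall c y, tr (const_to_var c y) B = B) -> uniq ps ->
  sorted (fun p q => code_size (enc (All q.1 q.2)) <=
                     code_size (enc (All p.1 p.2))) ps ->
  (forall p, p \in ps -> closed (All p.1 p.2)) ->
  prf (embed @` G `|` [set henkin p | p in [set p | p \in ps]]) B ->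
  prf (embed @` G) B.
Proof.
move=> cB hB; elim: ps => [|p ps IH] /= ups sps cps hp.
  by apply: prf_sub hp => C [//|[p]].
have /andP[pps {}ups] := ups.
have tr_le : transitive (fun p q : {classic nat * form (henkin_sig Th K)} =>
    code_size (enc (All q.1 q.2)) <= code_size (enc (All p.1 p.2))).
  by move=> q r s h1 h2; apply: leq_trans h2 h1.
have /allP lp := order_path_min tr_le sps.
apply: IH => //; first exact: path_sorted sps.
  by move=> q qps; apply: cps; rewrite inE qps orbT.
set H := [set henkin q | q in [set q | q \in ps]].
have cp : closed (All p.1 p.2) by apply: cps; rewrite inE eqxx.
have {hp} hp : prf (embed @` G `|` H) (Imp (henkin p) B).
  apply: deduction; first exact: closed_henkin.
  apply: prf_sub hp => C [GC|[q /=]]; first by left; left.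
  rewrite inE => /orP[/eqP -> <-|qps <-]; first by right.
  by left; right; exists q.
case: p pps sps cps lp cp hp => x A pps sps cps lp cp hp.
have [n /(_ (const_to_var (enc (All x A)) _)) hn] := prf_tr (K + code Th K) hp.
have [m hm] := free_bound A.
(* [y] has to be fresh for the derivation, for [A], and for the variables bound
   in the remaining axioms, so that the replacement commutes with their
   substitutions. *)
pose N := \max_(q <- ps) q.1.+1.
pose y := maxn n (maxn m (maxn x.+1 (maxn N (binder_bound A)))).
have {}hn : prf (tr (const_to_var (enc (All x A)) y) @` (embed @` G `|` H))
    (tr (const_to_var (enc (All x A)) y) (Imp (henkin (x, A)) B)).
  by apply: hn; apply: vars_ge_const_to_var; rewrite leq_maxl.
have xy : x < y by rewrite /y !leq_max leqnn !orbT.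
have trA : tr (const_to_var (enc (All x A)) y) A = A.
  by apply: tr_const_to_var_small; rewrite /= addn0.
move: hn; rewrite /= hB /henkin /= tr_subst; last exact: vars_ge_const_to_var.
rewrite trA /= {2}/const_to_var asboolT // => hn.
apply: (@drinker_elim _ _ x y A B) => //.
- by apply/negP => /hm; rewrite ltnNge /y !leq_max leqnn !orbT.
- apply: free_for_unbound => z hz /=; rewrite neq_ltn; apply/orP; right.
  by apply: leq_trans hz _; rewrite /y !leq_max leqnn !orbT.
apply: prf_sub hn => C [D [[E GE <-]|[[x' A'] qps <-]] <-].
  by left; exists E => //; rewrite tr_const_to_var_embed.
right; exists (x', A') => //; rewrite /henkin /=.
have sA' := lp _ qps.
have trA' : tr (const_to_var (enc (All x A)) y) A' = A'.
  by apply: tr_const_to_var_small; apply: leq_trans sA'; rewrite /= addn0.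
set u := witness x' A'.
have tru : trt (const_to_var (enc (All x A)) y) u = u.
  rewrite /= /const_to_var asboolF // => -[e1 /enc_inj e2].
  by move: pps; rewrite -e1 -e2 => /negP; apply.
rewrite [RHS]/= tr_subst ?trA' ?tru //; apply: vars_ge_const_to_var.
suff : x' < N by move/leq_trans; apply; rewrite /y !leq_max leqnn !orbT.
exact: (@leq_bigmax_seq _ ps xpredT (fun q => q.1.+1) (x', A')).
Qed.

(** A derivation uses finitely many Henkin axioms, which can be eliminated in
    the order of decreasing codes. *)
Lemma henkin_conservative (Th : signature) (K : Type)
    (G : set (form (with_consts Th K))) (B : form (with_consts Th K)) :
  closed B ->
  prf (embed @` G `|` [set henkin p | p in [set p | closed (All p.1 p.2)]])
      (embed B) ->
  prf G B.
Proof.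
move=> cB.
pose ax (ps : seq {classic nat * form (henkin_sig Th K)}) :=
  embed @` G `|` [set henkin p | p in [set p | p \in ps]].
have ax_cat ps qs : ax ps `<=` ax (ps ++ qs) /\ ax qs `<=` ax (ps ++ qs).
  by split=> C [|[p /= h <-]]; try (by left); right; exists p;
    rewrite //= mem_cat h ?orbT.
have fin C : prf (embed @` G `|`
      [set henkin p | p in [set p | closed (All p.1 p.2)]]) C ->
    exists2 ps : seq {classic nat * form (henkin_sig Th K)},
      (forall p, p \in ps -> closed (All p.1 p.2)) & prf (ax ps) C.
  elim=> {C} [C [GC|[p cp <-]]|C aC|C D _ [ps cps hps] _ [qs cqs hqs]|
    x C _ [ps cps hps]].
  - by exists [::] => //; apply: prf_hyp; left.
  - exists [:: (p : {classic _})] => [q|].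
      by rewrite inE => /eqP ->.
    by apply: prf_hyp; right; exists p; rewrite //= inE eqxx.
  - by exists [::] => //; apply: prf_ax.
  - exists (ps ++ qs) => [p|].
      by rewrite mem_cat => /orP[/cps|/cqs].
    have [h1 h2] := ax_cat ps qs.
    exact: prf_mp (prf_sub h1 hps) (prf_sub h2 hqs).
  - by exists ps => //; apply: prf_gen.
move=> /fin[ps cps hps].
pose le (p q : {classic nat * form (henkin_sig Th K)}) :=
  code_size (enc (All q.1 q.2)) <= code_size (enc (All p.1 p.2)).
have mem_qs p : p \in sort le (undup ps) = (p \in ps).
  by rewrite mem_sort mem_undup.
have hB : prf (embed @` G) (embed B).
  apply: (@henkin_elim _ _ _ _ (sort le (undup ps))).
  - by move=> x; rewrite free_in_tr.
  - by move=> c y; apply: tr_const_to_var_embed.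
  - by rewrite sort_uniq undup_uniq.
  - by apply: sort_sorted => p q; apply: leq_total.
  - by move=> p; rewrite mem_qs; apply: cps.
  - apply: prf_sub hps => C [|[p /= h <-]]; first by left.
    by right; exists p; rewrite //= mem_qs.
have [n hn] := prf_tr K hB.
pose g (k : K + code Th K) : K + nat := if k is inl c then inl c else inr n.
have gK C : tr g (@embed Th K C) = C.
  by apply: tr_id => k; exists (inl k).
have := hn g; rewrite gK => h; apply: prf_sub (h _).
  by move=> C [D [E GE <-] <-]; rewrite gK.
by case=> [k|c] y //= [<-].
Qed.

(** * Maximal theories *)

Lemma prf_chain (Th : signature) (G : set (form Th))
    (F : set (set (form Th))) A :
  total_on F subset -> prf (G `|` \bigcup_(X in F) X) A ->
  prf G A \/ exists2 X, F X & prf (G `|` X) A.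
Proof.
move=> tF; elim=> {A} [A [GA|[X FX XA]]|A aA|A B _ hB _ hBA|x A _ [h|[X FX h]]].
- by left; apply: prf_hyp.
- by right; exists X => //; apply: prf_hyp; right.
- by left; apply: prf_ax.
- have w X C : prf G C -> prf (G `|` X) C by apply: prf_sub => D; left.
  case: hB hBA => [hB|[X FX hB]] [hBA|[Y FY hBA]].
  + by left; apply: prf_mp hB hBA.
  + by right; exists Y => //; apply: prf_mp hBA; apply: w.
  + by right; exists X => //; apply: prf_mp hB _; apply: w.
  + have [XY|YX] := tF _ _ FX FY; right; [exists Y|exists X] => //.
      by apply: prf_mp hBA; apply: prf_sub hB; apply: setUS.
    by apply: prf_mp hB _; apply: prf_sub hBA; apply: setUS.
- by left; apply: prf_gen.
- by right; exists X => //; apply: prf_gen.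
Qed.

Lemma lindenbaum (Th : signature) (G : set (form Th)) B :
  ~ prf G B ->
  exists T, [/\ G `<=` T, ~ prf T B &
    forall A, closed A -> prf T A \/ prf T (Neg A)].
Proof.
(* Only sentences are added, so that the deduction theorem applies. *)
move=> GB; pose P X := X `<=` closed /\ ~ prf (G `|` X) B.
have [F PF tF|X [[cX XB] mX]] := @Zorn_bigcup _ P.
  split=> [A [X /PF[cX _] /cX //]|/(prf_chain tF)[//|[X /PF[]//]]].
exists (G `|` X); split=> // A cA; apply: contrapT => /not_orP[nA nNA].
have cons C : closed C -> ~ prf (G `|` X) C -> prf (G `|` X) (Imp C B).
  move=> cC nC; apply: deduction => //; rewrite -setUA; apply: contrapT => h.
  apply: (mX (X `|` [set C])); last first.
    by split=> // D [/cX|->].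
  split; first by move=> D; left.
  by move=> sX; apply: nC; apply: prf_hyp; right; apply: sX; right.
by apply: XB; apply: (@prf_cases _ _ A); apply: cons.
Qed.

(** For the sentences of such a theory, derivability commutes with the
    connectives and quantifiers as truth does. *)
Record henkin_theory {Th : signature} (T : set (form Th)) : Prop :=
  HenkinTheory {
    henkin_consistent : forall A, prf T A -> ~ prf T (Neg A);
    henkin_complete : forall A, closed A -> prf T A \/ prf T (Neg A);
    henkin_witness : forall x A, closed (All x A) -> exists2 t,
      closed_term t & prf T (subst x t A) -> prf T (All x A)
  }.

Lemma exists_henkin_theory (Th : signature) (K : Type)
    (G : set (form (with_consts Th K))) (B : form (with_consts Th K)) :
  closed B -> ~ prf G B ->
  exists T : set (form (henkin_sig Th K)),
    [/\ henkin_theory T, embed @` G `<=` T & ~ prf T (embed B)].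
Proof.
move=> cB nB.
have [|T [GT TB cT]] := @lindenbaum (henkin_sig Th K) (embed @` G `|`
    [set henkin p | p in [set p | closed (All p.1 p.2)]]) (embed B).
  by move/henkin_conservative => /(_ cB).
exists T; split=> //; last by move=> A GA; apply: GT; left.
split=> // [A hA hNA|x A cA].
  apply: TB; apply: (prf_mp hA); apply: (prf_mp hNA); exact: prf_exfalso.
exists (witness x A) => [y //|h]; apply: (prf_mp h).
by apply: prf_hyp; apply: GT; right; exists (x, A).
Qed.

(** * Derivability of sentences and identity *)

Lemma prf_Neg (Th : signature) (T : set (form Th)) A :
  henkin_theory T -> closed A -> prf T (Neg A) <-> ~ prf T A.
Proof.
move=> hT cA; split; first by move=> h1 h2; apply: henkin_consistent h2 h1.
by case: (henkin_complete hT cA).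
Qed.

Lemma prf_Imp (Th : signature) (T : set (form Th)) A B :
  henkin_theory T -> closed A ->
  prf T (Imp A B) <-> (prf T A -> prf T B).
Proof.
move=> hT cA; split; first by move=> h1 h2; apply: prf_mp h2 h1.
case: (henkin_complete hT cA) => [hA /(_ hA)|hA _]; first exact: prf_weak.
by apply: (prf_mp hA); apply: prf_exfalso.
Qed.

Lemma prf_All (Th : signature) (T : set (form Th)) x A :
  henkin_theory T -> closed (All x A) ->
  prf T (All x A) <-> (forall t, closed_term t -> prf T (subst x t A)).
Proof.
move=> hT cA; split=> [h t ct|h].
  apply: (prf_mp h); apply: prf_ax; apply: Ax4; exact: free_for_closed.
by have [t /h ht] := henkin_witness hT cA; apply.
Qed.

Lemma ssub_Eqn (Th : signature) (r : nat -> term Th) t u :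
  ssub r (Eqn t u) = Eqn (ssubt r t) (ssubt r u).
Proof.
by congr Atom; apply/ffunP => i; rewrite !ffunE; case: ifP.
Qed.

Lemma closed_Eqn (Th : signature) (t u : term Th) :
  closed_term t -> closed_term u -> closed (Eqn t u).
Proof.
move=> ct cu x /=; rewrite negb_exists; apply/forallP => i.
by rewrite ffunE; case: ifP.
Qed.

Lemma closed_upd_sub (Th : signature) (r : nat -> term Th) x t :
  (forall y, closed_term (r y)) -> closed_term t ->
  forall y, closed_term (upd_sub r x t y).
Proof. by move=> cr ct y; rewrite /upd_sub; case: ifP. Qed.

Lemma frepl_subst (Th : signature) x y (A : form Th) :
  frepl x y A (subst x (Var y) A).
Proof.
have ht (t : term Th) : trepl x y t (tsubst x (Var y) t).
  elim/term_args_ind: t => /= [z|c|f a IH].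
  - by case: eqP => [->|_]; constructor.
  - by constructor.
  - by apply: trepl_app => i; rewrite ffunE.
elim: A => [P a|A IH|A IH|z A IH|A IHA B IHB] /=; try by constructor.
- by apply: frepl_atom => i; rewrite ffunE.
- by case: (eqVneq z x) => [->|nzx]; constructor.
Qed.

(** (Ax8) identifies variables only; the law for closed terms is its instance
    for [x] and a fresh variable, to which [t] and [u] are then assigned. *)
Lemma prf_leibniz (Th : signature) (G : set (form Th)) (r : nat -> term Th)
    x t u A :
  (forall y, closed_term (r y)) -> closed_term t -> closed_term u ->
  prf G (Eqn t u) -> prf G (ssub (upd_sub r x t) A) ->
  prf G (ssub (upd_sub r x u) A).
Proof.
move=> cr ct cu htu hA.
have [n hn] := free_bound A.
pose y := maxn n (maxn x.+1 (binder_bound A)).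
have yA : ~~ free_in y A by apply/negP => /hn; rewrite ltnNge leq_maxl.
have xy : x != y.
  by rewrite neq_ltn; apply/orP; left; rewrite /y !leq_max leqnn !orbT.
have fA : free_for (Var y) x A.
  apply: free_for_unbound => z hz /=; rewrite neq_ltn; apply/orP; right.
  by apply: leq_trans hz _; rewrite /y !leq_max leqnn !orbT.
pose q := upd_sub (upd_sub r x t) y u.
have cq : forall z, closed_term (q z) by do 2! apply: closed_upd_sub => //.
have qx : q x = t by rewrite /q upd_sub_neq // upd_sub_eq.
have := @prf_ssub _ G q _ cq (prf_ax G (Ax8 fA (frepl_subst x y A))).
rewrite -[ssub q _]/(Imp (ssub q (Eqn _ _)) (Imp (ssub q A) (ssub q _))).
rewrite ssub_Eqn /= qx {1}/q upd_sub_eq => /(prf_mp htu).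
have -> : ssub q A = ssub (upd_sub r x t) A.
  apply: ssub_ext => z zA; rewrite /q upd_sub_neq //.
  by apply: contraTneq zA => ->.
move=> /(prf_mp hA); rewrite ssub_subst // /= {2}/q upd_sub_eq.
congr (prf G _); apply: ssub_ext => z zA; rewrite /q /upd_sub.
by case: (z =P x) => // _; case: eqP => // ezy; rewrite -ezy zA in yA.
Qed.

Lemma prf_Eqn_refl (Th : signature) (G : set (form Th)) t :
  closed_term t -> prf G (Eqn t t).
Proof.
move=> ct.
have h : prf G (Eqn (Var 0) (Var 0)).
  by apply/(prf_closure G 1); apply: prf_ax; apply: Ax7.
have := @prf_ssub _ G (fun=> t) _ (fun=> ct) h.
by rewrite ssub_Eqn.
Qed.

Lemma prf_Eqn_sym (Th : signature) (G : set (form Th)) t u :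
  closed_term t -> closed_term u -> prf G (Eqn t u) -> prf G (Eqn u t).
Proof.
move=> ct cu htu.
have := @prf_leibniz _ G (fun=> t) 0 t u (Eqn (Var 0) (Var 1))
  (fun=> ct) ct cu htu.
by rewrite !ssub_Eqn; apply; apply: prf_Eqn_refl.
Qed.

Lemma prf_Eqn_trans (Th : signature) (G : set (form Th)) t u w :
  closed_term t -> closed_term u -> closed_term w ->
  prf G (Eqn t u) -> prf G (Eqn u w) -> prf G (Eqn t w).
Proof.
move=> ct cu cw htu huw.
have := @prf_leibniz _ G (fun=> t) 0 u w (Eqn (Var 1) (Var 0))
  (fun=> ct) cu cw huw.
by rewrite !ssub_Eqn; apply.
Qed.

Lemma prf_congr (Th : signature) (G : set (form Th)) (r r' : nat -> term Th) A :
  (forall y, closed_term (r y)) -> (forall y, closed_term (r' y)) ->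
  (forall y, prf G (Eqn (r y) (r' y))) ->
  prf G (ssub r A) -> prf G (ssub r' A).
Proof.
move=> cr cr' hr hA; pose q n y := if y < n then r' y else r y.
have hq n : prf G (ssub (q n) A).
  elim: n => [|n IH]; first by rewrite (_ : q 0 = r) //; apply/funext.
  have -> : q n.+1 = upd_sub (q n) n (r' n).
    apply/funext => y; rewrite /upd_sub /q ltnS leq_eqVlt.
    by case: eqVneq => // ->.
  apply: (@prf_leibniz _ _ _ _ (r n)) => //.
    by move=> y; rewrite /q; case: ifP.
  rewrite (_ : upd_sub _ _ _ = q n) //; apply/funext => y.
  by rewrite /upd_sub; case: eqP => // ->; rewrite /q ltnn.
have [n hn] := free_bound A.
by rewrite (@ssub_ext _ _ (q n)) // => y /hn yn; rewrite /q yn.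
Qed.

(** * The truth value of a sentence *)

Definition val {Th : signature} (T : set (form Th)) (A : form Th) : V4 :=
  if `[< prf T (Box A) >] then Tp
  else if `[< prf T A >] then Cp
  else if `[< prf T (Box (Neg A)) >] then Fm
  else Cm.

Inductive val_spec {Th : signature} (T : set (form Th)) (A : form Th) :
    V4 -> Prop :=
| ValTp of prf T (Box A) & prf T A & ~ prf T (Box (Neg A)) : val_spec T A Tp
| ValCp of ~ prf T (Box A) & prf T A & ~ prf T (Box (Neg A)) : val_spec T A Cp
| ValCm of ~ prf T (Box A) & ~ prf T A & ~ prf T (Box (Neg A)) :
    val_spec T A Cm
| ValFm of ~ prf T (Box A) & ~ prf T A & prf T (Box (Neg A)) : val_spec T A Fm.

Lemma prf_T (Th : signature) (G : set (form Th)) A :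
  prf G (Box A) -> prf G A.
Proof. exact: prf_ax_mp (AxT A). Qed.

Lemma valP (Th : signature) (T : set (form Th)) A :
  henkin_theory T -> val_spec T A (val T A).
Proof.
move=> hT; have h1 := @prf_T _ T A; have h2 := @prf_T _ T (Neg A).
have h3 := @henkin_consistent _ _ hT A; rewrite /val.
case: asboolP => hB; first by constructor; tauto.
case: asboolP => hA; first by constructor; tauto.
by case: asboolP => hN; constructor; tauto.
Qed.

Lemma val_iff (Th : signature) (T : set (form Th)) A B :
  (prf T A <-> prf T B) -> (prf T (Box A) <-> prf T (Box B)) ->
  (prf T (Box (Neg A)) <-> prf T (Box (Neg B))) -> val T A = val T B.
Proof. by rewrite /val => /propext -> /propext -> /propext ->. Qed.

Lemma val_congr (Th : signature) (T : set (form Th)) (r r' : nat -> term Th) A :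
  (forall y, closed_term (r y)) -> (forall y, closed_term (r' y)) ->
  (forall y, prf T (Eqn (r y) (r' y))) ->
  val T (ssub r A) = val T (ssub r' A).
Proof.
move=> cr cr' hr.
have hr' y : prf T (Eqn (r' y) (r y)) by apply: prf_Eqn_sym.
have e B : prf T (ssub r B) <-> prf T (ssub r' B).
  by split; apply: prf_congr.
apply: val_iff; first exact: e.
  exact: (e (Box A)).
exact: (e (Box (Neg A))).
Qed.

Lemma designated_val (Th : signature) (T : set (form Th)) A :
  henkin_theory T -> designated (val T A) <-> prf T A.
Proof.
move=> hT; case: (valP A hT) => _ h _; split=> // h'; rewrite /designated /=.
- by left.
- by right.
- by case: h'.
- by case: h'.
Qed.

Lemma mneg_val (Th : signature) (T : set (form Th)) A :
  henkin_theory T -> closed A -> mneg (val T A) (val T (Neg A)).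
Proof.
move=> hT cA; have hN := prf_Neg hT cA.
have h1 := @prf_ax_mp _ T _ _ (AxDN1 A).
have h2 := @prf_ax_mp _ T _ _ (AxDN2 A).
by case: (valP A hT) => ???; case: (valP (Neg A) hT) => ??? //=; tauto.
Qed.

Lemma mbox_val (Th : signature) (T : set (form Th)) A :
  henkin_theory T -> mbox (val T A) (val T (Box A)).
Proof.
move=> hT; case: (valP A hT) => ???; case: (valP (Box A) hT) => ??? //=; tauto.
Qed.

Lemma closed_Imp (Th : signature) (A B : form Th) :
  closed A -> closed B -> closed (Imp A B).
Proof. by move=> cA cB x /=; rewrite negb_or cA cB. Qed.

(** In each cell of the table the values left out are refuted by one of (K),
    (K1), (K2) and (M1) to (M4), once [Neg (Box (Neg A))] is read as the failure
    of [Box (Neg A)]. *)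
Lemma mimp_val (Th : signature) (T : set (form Th)) A B :
  henkin_theory T -> closed A -> closed B ->
  mimp (val T A) (val T B) (val T (Imp A B)).
Proof.
move=> hT cA cB; have hI := prf_Imp B hT cA.
have ax := @prf_ax_mp _ T.
have hDia C : closed C -> prf T (Dia C) <-> ~ prf T (Box (Neg C)).
  by move=> cC; apply: prf_Neg.
have hDA := hDia _ cA; have hDB := hDia _ cB.
have hDI := hDia _ (closed_Imp cA cB).
have hDN : prf T (Dia (Neg A)) <-> ~ prf T (Box A).
  rewrite (hDia (Neg A)) //; split=> h h'; apply: h; move: h'; apply: ax.
    exact: AxDN1.
  exact: AxDN2.
have aK := ax _ _ (AxK A B); have aK1 := ax _ _ (AxK1 A B).
have aK2 := ax _ _ (AxK2 A B); have aM1 := ax _ _ (AxM1 A B).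
have aM2 := ax _ _ (AxM2 A B); have aM3 := ax _ _ (AxM3 A B).
have aM4 := ax _ _ (AxM4 A B).
have {}aK : prf T (Box (Imp A B)) -> prf T (Box A) -> prf T (Box B).
  by move=> /aK h h'; apply: prf_mp h' h.
have {}aK1 : prf T (Box (Imp A B)) -> prf T (Dia A) -> prf T (Dia B).
  by move=> /aK1 h h'; apply: prf_mp h' h.
have {}aK2 : prf T (Dia (Imp A B)) -> prf T (Box A) -> prf T (Dia B).
  by move=> /aK2 h h'; apply: prf_mp h' h.
case: (valP A hT) => ???; case: (valP B hT) => ???;
  by case: (valP (Imp A B) hT) => ??? //=; tauto.
Qed.

Lemma val_rank (Th : signature) (T : set (form Th)) A :
  henkin_theory T ->
  [/\ 2 < V4rank (val T A) <-> prf T (Box A), 1 < V4rank (val T A) <-> prf T A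
    & 0 < V4rank (val T A) <-> ~ prf T (Box (Neg A))].
Proof. by move=> hT; case: (valP A hT) => ??? /=; split; split. Qed.

Lemma V4rank_inj : injective V4rank.
Proof. by case=> [] [] //. Qed.

(** (CBF), (PBF) and instantiation bound the value of [All x A] by the values of
    its instances; (BF), (NBF) and the witnesses of the theory for
    [All x (Box A)], [All x A] and [All x (Dia A)] show that the bound is
    attained. *)
Lemma mall_val (Th : signature) (T : set (form Th)) x A :
  henkin_theory T -> closed (All x A) ->
  mall [set val T (subst x t A) | t in closed_term] (val T (All x A)).
Proof.
move=> hT cA.
have ax := @prf_ax_mp _ T.
have cs t : closed_term t -> closed (subst x t A).
  move=> ct y; rewrite subst_ssub1; apply: free_in_ssub => z zA.
  rewrite /upd_sub; case: eqP => //= /eqP nzx.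
  by have := cA z; rewrite /= zA andbT eq_sym nzx.
have hDia C : closed C -> prf T (Dia C) <-> ~ prf T (Box (Neg C)).
  by move=> cC; apply: prf_Neg.
have hB : prf T (Box (All x A)) <->
    forall t, closed_term t -> prf T (Box (subst x t A)).
  rewrite -(prf_All hT (A := Box A)) //.
  by split; apply: ax; [apply: AxCBF|apply: AxBF].
have hD : ~ prf T (Box (Neg (All x A))) <->
    forall t, closed_term t -> ~ prf T (Box (Neg (subst x t A))).
  rewrite -hDia //; split=> [h t ct|h].
    have /(prf_All hT (A := Dia A)) : prf T (All x (Dia A)).
      by apply: ax h; apply: AxPBF.
    by move=> /(_ cA t ct); rewrite /= -/(Dia _) hDia //; apply: cs.
  apply: (@ax (All x (Dia A))); first exact: AxNBF.
  apply/(prf_All hT (A := Dia A)) => // t ct.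
  by rewrite /= -/(Dia _) hDia; [apply: h|apply: cs].
have hA := prf_All hT cA.
have le t : closed_term t ->
    V4rank (val T (All x A)) <= V4rank (val T (subst x t A)).
  move=> ct; have [r3 r2 r1] := val_rank (subst x t A) hT.
  have [q3 q2 q1] := val_rank (All x A) hT.
  case e: (V4rank (val T (All x A))) q1 q2 q3 => [|[|[|n]]] // q1 q2 q3.
  - by apply/r1; move: t ct {r1 r2 r3}; apply/hD; apply/q1.
  - by apply/r2; move: t ct {r1 r2 r3}; apply/hA; apply/q2.
  - have : V4rank (val T (All x A)) <= 3 by case: (val T (All x A)).
    rewrite e !ltnS leqn0 => /eqP n0; rewrite n0.
    by apply/r3; move: t ct {r1 r2 r3}; apply/hB; apply/q3.
split; last by move=> _ [t ct <-]; apply: le.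
suff [t ct h] : exists2 t, closed_term t &
    V4rank (val T (subst x t A)) <= V4rank (val T (All x A)).
  by exists t => //; apply: V4rank_inj; apply/eqP; rewrite eqn_leq h le.
have ex (Q : term Th -> Prop) :
    ~ (forall t, closed_term t -> Q t) -> exists2 t, closed_term t & ~ Q t.
  by move=> /existsNP[t /not_implyP[ct h]]; exists t.
case: (valP (All x A) hT) => [_ _ _|/hB/ex[t ct h] _ _|_ /hA/ex[t ct h] _|
  _ _ h].
- have [t ct _] := henkin_witness hT cA; exists t => //.
  by case: (val T _).
- by exists t => //; case: valP.
- by exists t => //; case: valP.
- have /ex[t ct h'] : ~ forall t, closed_term t ->
      ~ prf T (Box (Neg (subst x t A))) by move/hD; apply.
  by exists t => //; case: valP.
Qed.

(** * The term model *)

Definition eq_class {Th : signature} (T : set (form Th)) (t : term Th) :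
    set (term Th) :=
  [set u | closed_term u /\ prf T (Eqn t u)].

Definition choose_term {Th : signature} (X : set (term Th)) : term Th :=
  if pselect (exists t, X t) is left h then sval (cid h) else Var 0.

(** Identity has to be interpreted as equality, so a term stands for its class
    modulo derivable identity. *)
Definition repr {Th : signature} (T : set (form Th)) (t : term Th) : term Th :=
  choose_term (eq_class T t).

Lemma repr_class (Th : signature) (T : set (form Th)) t :
  closed_term t -> eq_class T t (repr T t).
Proof.
move=> ct; rewrite /repr /choose_term; case: pselect => [h|[]].
  exact: (svalP (cid h)).
by exists t; split=> //; apply: prf_Eqn_refl.
Qed.

Lemma repr_eq (Th : signature) (T : set (form Th)) t u :
  closed_term t -> closed_term u ->
  repr T t = repr T u <-> prf T (Eqn t u).
Proof.
move=> ct cu; have [crt tr] := repr_class T ct.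
have [cru ur] := repr_class T cu; split=> [e|h].
  by apply: (prf_Eqn_trans _ cru) => //; [rewrite -e|apply: prf_Eqn_sym].
congr choose_term; apply/predeqP => w; split=> -[cw hw]; split=> //.
  by apply: (prf_Eqn_trans _ ct) => //; apply: prf_Eqn_sym.
exact: (prf_Eqn_trans _ cu).
Qed.

Definition tdom {Th : signature} (T : set (form Th)) : Type :=
  {t : term Th | closed_term t /\ repr T t = t}.

Lemma tdom_inj (Th : signature) (T : set (form Th)) (d e : tdom T) :
  sval d = sval e -> d = e.
Proof.
case: d e => [t p] [u q] /= etu; case: u / etu q => q.
by congr exist; apply: Prop_irrelevance.
Qed.

Definition class_of {Th : signature} (T : set (form Th)) (t : term Th)
    (ct : closed_term t) : tdom T.
Proof.
exists (repr T t); have [cr er] := repr_class T ct; split=> //.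
by apply/repr_eq => //; apply: prf_Eqn_sym.
Defined.

Lemma closed_App (Th : signature) (f : fun_sym Th)
    (a : (term Th ^ far f)%type) :
  (forall i, closed_term (a i)) -> closed_term (App f a).
Proof.
by move=> ca x /=; rewrite negb_exists; apply/forallP => i; apply: ca.
Qed.

Lemma tdom_closed (Th : signature) (T : set (form Th)) n
    (u : (tdom T ^ n)%type) i :
  @closed_term Th ([ffun j => sval (u j)] i).
Proof. by rewrite ffunE; case: (svalP (u i)). Qed.

Lemma tdom_inhabited (Th : signature) (T : set (form Th)) :
  henkin_theory T -> inhabited (tdom T).
Proof.
move=> hT; have c0 : closed (All 0 (@Eqn Th (Var 0) (Var 0))).
  move=> x /=; apply/negP => /andP[nx /existsP[i]].
  by rewrite ffunE; case: ifP => _ /= /eqP e; rewrite e eqxx in nx.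
by have [t ct _] := henkin_witness hT c0; exists; apply: class_of ct.
Qed.

Definition tatom {Th : signature} {T : set (form Th)} (P : pred_sym Th)
    (u : (tdom T ^ par P)%type) : form Th :=
  Atom P [ffun i => sval (u i)].

(** (N=) and (P=), instantiated by closed terms, exclude the two contingent
    values. *)
Lemma val_Eqn (Th : signature) (T : set (form Th)) t u :
  henkin_theory T -> closed_term t -> closed_term u ->
  (val T (Eqn t u) = Tp <-> prf T (Eqn t u)) /\
  (val T (Eqn t u) = Fm <-> ~ prf T (Eqn t u)).
Proof.
move=> hT ct cu; pose r y := if y == 0 then t else u.
have cr y : closed_term (r y) by rewrite /r; case: ifP.
have e : ssub r (Eqn (Var 0) (Var 1)) = Eqn t u by rewrite ssub_Eqn.
have := prf_ssub cr (prf_ax T (AxNeq 0 1)).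
have := prf_ssub cr (prf_ax T (AxPeq 0 1)).
rewrite -[ssub r (Imp (Neg _) _)]/(Imp (Neg (ssub r (Eqn _ _)))
  (Box (Neg (ssub r (Eqn _ _))))).
rewrite -[ssub r (Imp _ _)]/(Imp (ssub r (Eqn _ _)) (Box (ssub r (Eqn _ _)))).
have ctu := closed_Eqn ct cu; have hN := prf_Neg hT ctu.
rewrite e => /(prf_Imp _ hT) h1 /(prf_Imp _ hT) h2.
have {}h1 := h1 ctu; have {}h2 := h2 ctu.
by case: (valP (Eqn t u) hT) => ???; split; split=> //; tauto.
Qed.

Lemma pair2_eta (Th : signature) (X : Type) (u : (X ^ par (ident Th))%type) :
  exists a b, u = pair2 a b.
Proof.
have h0 : 0 < par (ident Th) by rewrite par_ident.
have h1 : 1 < par (ident Th) by rewrite par_ident.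
exists (u (Ordinal h0)), (u (Ordinal h1)); apply/ffunP => i; rewrite ffunE.
case: eqP => [i0|i0]; congr (u _); apply: val_inj => //=.
have := ltn_ord i; rewrite -[X in _ < X -> _]/(par (ident Th)).
by move: i0; case: (nat_of_ord i) => [|[|k]] // _; rewrite par_ident.
Qed.

Lemma tatom_ident (Th : signature) (T : set (form Th)) (a b : tdom T) :
  tatom (pair2 a b : (tdom T ^ par (ident Th))%type) = Eqn (sval a) (sval b).
Proof. by congr Atom; apply/ffunP => i; rewrite !ffunE; case: ifP. Qed.

Definition tapred {Th : signature} (T : set (form Th)) (P : pred_sym Th) :
    set (tdom T ^ par P) :=
  [set u | prf T (tatom u)].

(** The contingent atoms are those with value C+ or C-. *)
Definition tcpred {Th : signature} (T : set (form Th)) (P : pred_sym Th) :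
    set (tdom T ^ par P) :=
  [set u | ~ prf T (Box (tatom u)) /\ ~ prf T (Box (Neg (tatom u)))].

Lemma tapred_ident (Th : signature) (T : set (form Th)) :
  @tapred Th T (ident Th) = [set u | exists a, u = pair2 a a].
Proof.
apply/predeqP => u; have [a [b ->]] := pair2_eta u.
have [[ca ea] [cb eb]] := (svalP a, svalP b).
rewrite /tapred /= tatom_ident -repr_eq // ea eb; split=> [/tdom_inj ->|].
  by exists b.
move=> [c /ffunP e]; have h1 : 1 < par (ident Th) by rewrite par_ident.
have := e (Ordinal (ltnW h1)); have := e (Ordinal h1).
by rewrite !ffunE /= => -> ->.
Qed.

Lemma tcpred_ident (Th : signature) (T : set (form Th)) :
  henkin_theory T -> @tcpred Th T (ident Th) = set0.
Proof.
move=> hT; apply/predeqP => u; have [a [b ->]] := pair2_eta u.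
have [[ca ea] [cb eb]] := (svalP a, svalP b).
have := val_Eqn hT ca cb; rewrite /tcpred /= tatom_ident.
by case: (valP (Eqn (sval a) (sval b)) hT) => ??? []; intuition discriminate.
Qed.

Definition term_model {Th : signature} {T : set (form Th)}
    (hT : henkin_theory T) : structure Th :=
  @Structure Th (tdom T) (tdom_inhabited hT) (@tapred Th T) (@tcpred Th T)
    (tapred_ident T) (tcpred_ident hT)
    (fun f u => class_of T (closed_App (@tdom_closed Th T _ u)))
    (fun c => class_of T (fun x => isT : ~~ occurs x (Cst c))).

Definition as_sub {Th : signature} {T : set (form Th)} {hT : henkin_theory T}
    (s : assignment (term_model hT)) : nat -> term Th :=
  fun x => sval (s x).

Definition term_val {Th : signature} {T : set (form Th)} (hT : henkin_theory T)
    (A : form Th) (s : assignment (term_model hT)) : V4 :=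
  val T (ssub (as_sub s) A).

Lemma closed_as_sub (Th : signature) (T : set (form Th))
    (hT : henkin_theory T) (s : assignment (term_model hT)) x :
  closed_term (as_sub s x).
Proof. by case: (svalP (s x)). Qed.

Definition arg_sub {Th : signature} {n : nat} (n_gt0 : 0 < n)
    (u : (term Th ^ n)%type) : nat -> term Th :=
  fun j => u (insubd (Ordinal n_gt0) j).

Lemma prf_Eqn_App (Th : signature) (T : set (form Th)) (f : fun_sym Th)
    (a b : (term Th ^ far f)%type) :
  (forall i, closed_term (a i)) -> (forall i, closed_term (b i)) ->
  (forall i, prf T (Eqn (a i) (b i))) -> prf T (Eqn (App f a) (App f b)).
Proof.
move=> ca cb hab; have f0 := far_gt0 f.
pose A := Eqn (App f a) (App f [ffun i => Var (nat_of_ord i)]).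
have e u : ssub (arg_sub f0 u) A = Eqn (App f a) (App f u).
  rewrite ssub_Eqn; congr Eqn.
    rewrite -[RHS]ssubt_id; apply: ssubt_ext => x hx.
    by have := closed_App ca x; rewrite hx.
  by rewrite /=; congr App; apply/ffunP => i; rewrite !ffunE /= /arg_sub valKd.
rewrite -e; apply: (@prf_congr _ _ (arg_sub f0 a)) => [y|y|y|].
- exact: ca.
- exact: cb.
- exact: hab.
by rewrite e; apply: prf_Eqn_refl; apply: closed_App.
Qed.

Lemma val_Atom_congr (Th : signature) (T : set (form Th)) (P : pred_sym Th)
    (a b : (term Th ^ par P)%type) :
  (forall i, closed_term (a i)) -> (forall i, closed_term (b i)) ->
  (forall i, prf T (Eqn (a i) (b i))) -> val T (Atom P a) = val T (Atom P b).
Proof.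
move=> ca cb hab; have P0 := par_gt0 P.
have e u : Atom P u =
    ssub (arg_sub P0 u) (Atom P [ffun i => Var (nat_of_ord i)]).
  by rewrite /=; congr Atom; apply/ffunP => i; rewrite !ffunE /= /arg_sub valKd.
rewrite (e a) (e b); apply: val_congr => y; [exact: ca|exact: cb|exact: hab].
Qed.

Lemma sval_denot (Th : signature) (T : set (form Th)) (hT : henkin_theory T)
    (s : assignment (term_model hT)) t :
  sval (denot s t) = repr T (ssubt (as_sub s) t).
Proof.
have cs := closed_as_sub s.
elim/term_args_ind: t => [x|c|f a IH] //=.
  by have [_ <-] := svalP (s x).
apply/repr_eq.
- exact: closed_App (@tdom_closed _ _ _ _).
- by apply: closed_App => i; rewrite ffunE; apply: closed_ssubt.
apply: prf_Eqn_App => i; rewrite !ffunE.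
- by rewrite IH; apply: (repr_class T _).1; apply: closed_ssubt.
- exact: closed_ssubt.
- have ca : closed_term (ssubt (as_sub s) (a i)) by apply: closed_ssubt.
  have [cr h] := repr_class T ca.
  by rewrite IH; apply: prf_Eqn_sym.
Qed.

(** The denotation of a term and its substitution instance are different but
    provably identical terms, and [val_congr] lets either stand for the
    other. *)
Lemma term_val_valuation (Th : signature) (T : set (form Th))
    (hT : henkin_theory T) : valuation (@term_val Th T hT).
Proof.
have cs := @closed_as_sub Th T hT.
have repr_prf (t : term Th) (ct : closed_term t) := repr_class T ct.
have term_val_upd x t A (s : assignment (term_model hT)) (d : tdom T) :
    closed_term t -> sval d = repr T t ->
    term_val A (upd s x d) = val T (ssub (upd_sub (as_sub s) x t) A).
  move=> ct ed; have [cr hr] := repr_prf t ct.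
  apply: val_congr => [y|y|y].
  - exact: cs.
  - by apply: closed_upd_sub => //; apply: cs.
  - rewrite /as_sub /upd /upd_sub; case: ifP => _.
      by rewrite ed; apply: prf_Eqn_sym.
    by apply: prf_Eqn_refl; apply: (cs s).
split.
- move=> P a s u.
  have -> : term_val (Atom P a) s = val T (tatom u).
    apply: val_Atom_congr => i; rewrite !ffunE.
    + by apply: closed_ssubt; apply: cs.
    + rewrite sval_denot; apply: (repr_prf _ _).1.
      by apply: closed_ssubt; apply: cs.
    + rewrite sval_denot; apply: (repr_prf _ _).2.
      by apply: closed_ssubt; apply: cs.
  rewrite /= /tapred /tcpred /setD /setI /setU /setC /=.
  by case: (valP (tatom u) hT) => ???; split; split=> //; tauto.
- move=> t1 t2 s; rewrite /term_val ssub_Eqn.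
  have c1 : closed_term (ssubt (as_sub s) t1) by apply: closed_ssubt; apply: cs.
  have c2 : closed_term (ssubt (as_sub s) t2) by apply: closed_ssubt; apply: cs.
  have -> : (denot s t1 = denot s t2) =
      prf T (Eqn (ssubt (as_sub s) t1) (ssubt (as_sub s) t2)).
    apply/propext; rewrite -repr_eq // -!sval_denot.
    by split=> [->|/tdom_inj].
  exact: val_Eqn.
- by move=> A s; apply: mneg_val => //; apply: closed_ssub; apply: cs.
- by move=> A s; apply: mbox_val.
- by move=> A B s; apply: mimp_val => //; apply: closed_ssub; apply: cs.
- move=> x A s; pose r := upd_sub (as_sub s) x (Var x).
  have cA : closed (All x (ssub r A)).
    exact: (@closed_ssub _ _ (All x A) (cs s)).
  have inst t : subst x t (ssub r A) = ssub (upd_sub (as_sub s) x t) A.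
    rewrite subst_ssub => [|y nyx]; last first.
      by rewrite /r upd_sub_neq //; apply: cs.
    apply: ssub_ext => y _; rewrite /r /upd_sub; case: eqP => /= [_|_].
      by rewrite eqxx.
    by apply: tsubst_notin; apply: cs.
  have := mall_val hT cA; rewrite /term_val /=.
  congr (mall _ _); apply/predeqP => m; split=> [[t ct <-]|[s' ss' <-]].
    exists (upd s x (class_of T ct)); last by rewrite inst; apply: term_val_upd.
    by move=> y nyx; rewrite /upd (negbTE nyx).
  exists (as_sub s' x); first exact: cs.
  rewrite inst; congr (val T _); apply: ssub_ext => y _.
  by rewrite /upd_sub; case: eqP => [->|/eqP nyx] //; rewrite /as_sub ss'.
- move=> z t A s fA; rewrite (term_val_upd z (ssubt (as_sub s) t)).
  + by rewrite /term_val ssub_subst.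
  + by apply: closed_ssubt; apply: cs.
  + exact: sval_denot.
- move=> A B s hAB.
  have e C D : variant C D ->
      prf T (ssub (as_sub s) C) <-> prf T (ssub (as_sub s) D).
    move=> hCD; have h E F : variant E F ->
        prf T (ssub (as_sub s) E) -> prf T (ssub (as_sub s) F).
      move=> hEF hE; apply: (prf_mp hE).
      exact: prf_ssub (cs s) (prf_ax T (Ax6 hEF)).
    by split; apply: h => //; apply: variant_sym.
  apply: val_iff; first exact: e.
    by apply: (e (Box A) (Box B)); apply: variant_box.
  apply: (e (Box (Neg A)) (Box (Neg B))).
  by apply: variant_box; apply: variant_neg.
- move=> x y A A' s fA hA; apply/designated_val => //.
  exact: prf_ssub (cs s) (prf_ax T (Ax8 fA hA)).
Qed.

Lemma term_model_true (Th : signature) (T : set (form Th))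
    (hT : henkin_theory T) A :
  prf T A -> true_in (@term_val Th T hT) A.
Proof.
move=> hA s; apply/designated_val => //.
by apply: prf_ssub hA; apply: closed_as_sub.
Qed.

Lemma true_term_model (Th : signature) (T : set (form Th))
    (hT : henkin_theory T) A :
  closed A -> true_in (@term_val Th T hT) A -> prf T A.
Proof.
move=> cA hA; have [d] := tdom_inhabited hT.
by have /designated_val := hA (fun=> d); rewrite ssub_closed //; apply.
Qed.

(** * Completeness *)

Lemma true_closure (Th : signature) (M : structure Th)
    (v : form Th -> assignment M -> V4) n A :
  valuation v -> true_in v A -> true_in v (closure n A).
Proof.
move=> hv hA; elim: n => //= n IH s.
by have [[s' _ <-] _] := val_all hv n (closure n A) s; apply: IH.
Qed.

Definition reduct {Th : signature} {K : Type}
    (M : structure (henkin_sig Th K)) : structure (with_consts Th K) :=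
  @Structure (with_consts Th K) (dom M) (dom_inhabited M) (@apred _ M)
    (@cpred _ M) (@apred_ident _ M) (@cpred_ident _ M) (@fint _ M)
    (fun k => cint M (inl k : const_sym (henkin_sig Th K))).

Lemma denot_reduct (Th : signature) (K : Type) (M : structure (henkin_sig Th K))
    (s : assignment M) (t : term (with_consts Th K)) :
  denot s (trt (fun k => inl (inl k)) t : term (henkin_sig Th K)) =
  @denot _ (reduct M) s t.
Proof.
elim/term_args_ind: t => //= f a IH; congr (fint M _ _).
by apply/ffunP => i; rewrite !ffunE.
Qed.

Lemma valuation_reduct (Th : signature) (K : Type)
    (M : structure (henkin_sig Th K))
    (v : form (henkin_sig Th K) -> assignment M -> V4) :
  valuation v ->
  @valuation _ (reduct M) (fun A => v (embed A)).
Proof.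
have ge0 n :
    vars_ge n (fun k : K => inl (inl k : K + code Th K) : _ + nat) by [].
case=> hatom heqn hneg hbox himp hall hsub hvar hrep; split.
- move=> P a s u; rewrite /embed /=.
  pose b : term (henkin_sig Th K) ^ par P :=
    [ffun i : 'I_(@par Th P) => trt (fun k => inl (inl k)) (a i)].
  have -> : u = [ffun i => @denot _ M s (b i)].
    by apply/ffunP => i; rewrite !ffunE denot_reduct.
  exact: hatom.
- by move=> t1 t2 s; rewrite /embed tr_Eqn -!denot_reduct; apply: heqn.
- by move=> A s; apply: hneg.
- by move=> A s; apply: hbox.
- by move=> A B s; apply: himp.
- by move=> x A s; apply: hall.
- move=> z t A s fA; rewrite /embed tr_subst // -denot_reduct; apply: hsub.
  exact: free_for_tr.
- move=> A B s hAB; apply: hvar.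
  by have [n] := variant_tr (K + code Th K) hAB; apply.
- move=> x y A A' s fA hA.
  have := @hrep x y (embed A) (embed A') s.
  rewrite -[embed (Imp _ _)]/(Imp (embed (Eqn _ _)) (Imp (embed A) (embed A'))).
  rewrite /embed tr_Eqn; apply.
    exact: (@free_for_tr _ _ _ _ x (Var y)).
  exact: frepl_tr.
Qed.

Lemma completeness (Th : signature) (K : Type)
    (G : set (form (with_consts Th K))) (A : form (with_consts Th K)) :
  entails G A -> prf G A.
Proof.
move=> hG; have [n cA] := exists_closure A.
apply/(prf_closure G n); apply: contrapT => nA.
have [T [hT GT TA]] := exists_henkin_theory cA nA.
have hv := term_val_valuation hT; have hv' := valuation_reduct hv.
apply: TA; apply: (true_term_model (hT := hT)).
  by move=> x; rewrite free_in_tr.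
apply: (true_closure n hv' (hG _ _ hv' _)) => B GB s.
by apply: term_model_true; apply: prf_hyp; apply: GT; exists B.
Qed.

Theorem theorem2p25 (Th : signature) (G : set (form Th)) (phi : form Th)
    (hG : entails G phi) : derives G phi.
Proof.
apply: prf_derives.
(* The signature is its own expansion by its own constants once it is an
   explicit record. *)
case: Th G phi hG => P ar ar0 eqP ar2 F far far0 K G phi.
exact: (@completeness (Signature ar0 ar2 far0 K) K G phi).
Qed.
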